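(* For any $\mathbf{obj}\in\{\mathsf{r},\mathsf{m}\}$ and any $\mathbf{crit}\subseteq\{\mathbb{E},\mathrm{CVaR},\mathrm{VaR}\}$ with $|\mathbf{crit}|=1$, deterministic memoryless strategies are sufficient for $\mathsf{MDP}^{\mathbf{crit}}_{\mathbf{obj},\mathsf{single}}$: whenever some strategy satisfies a single-dimensional query consisting of one lower-bound constraint of the type in $\mathbf{crit}$ on the weighted reachability reward ($\mathbf{obj}=\mathsf{r}$) or mean payoff ($\mathbf{obj}=\mathsf{m}$), some deterministic memoryless strategy satisfies it.
   Context: An MDP $\mathcal{M}=(S,\mathsf{A},\mathsf{Av},\Delta,s_0)$: finite states and actions, $\mathsf{Av}(s)\neq\emptyset$ partitioning $\mathsf{A}$, $\Delta:\mathsf{A}\to\mathcal{D}(S)$, initial state $s_0$. Strategies $\sigma=(\sigma_u,\sigma_n,\alpha)$ over countable memory $\mathsf{M}$ ($\sigma_u:\mathsf{A}\times S\times\mathsf{M}\to\mathcal{D}(\mathsf{M})$, $\sigma_n:S\times\mathsf{M}\to\mathcal{D}(\mathsf{A})$, $\alpha\in\mathcal{D}(\mathsf{M})$) induce $\mathbb{P}^\sigma$ on runs; deterministic memoryless means $|\mathsf{M}|=1$ and $\sigma_n$ Dirac. Weighted reachability: absorbing target set $T$, $\mathbf{r}:T\to\mathbb{Q}$, $R^{\mathsf{r}}(\rho)$ = reward of first visited target state, $0$ if none. Mean payoff: $\mathbf{r}:S\to\mathbb{Q}$, $R^{\mathsf{m}}(\rho)=\liminf_n\frac1n\sum_{i=1}^n\mathbf{r}(\rho_i)$.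 Constraints have the form $\mathsf{e}\le\mathbb{E}^\sigma[X]$, $\mathsf{c}\le\mathrm{CVaR}^\sigma_{\mathsf{p}}(X)$ or $\mathsf{v}\le\mathrm{VaR}^\sigma_{\mathsf{q}}(X)$ with $\mathsf{p},\mathsf{q}\in(0,1)$, where $\mathrm{VaR}_p(X)=\sup\{r\mid F_X(r)\le p\}$ and, with $v=\mathrm{VaR}_p(X)$, $\mathrm{CVaR}_p(X)=\frac1p\big(\int_{(-\infty,v)}x\,dF_X+(p-\mathbb{P}[X<v])v\big)$. *)

(* Defs.v *)
From HB Require Import structures.
From mathcomp Require Import all_boot all_order all_algebra.
From mathcomp Require Import all_classical all_reals all_analysis.
From mathcomp Require Import measurable_realfun.

Set Implicit Arguments.
Unset Strict Implicit.
Unset Printing Implicit Defensive.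

Import Order.TTheory GRing.Theory Num.Theory.
Import numFieldNormedType.Exports.

Local Open Scope classical_set_scope.
Local Open Scope ring_scope.

(* D(X), used for finite and for countable X: an unordered sum over all of X. *)
Record distr (R : realType) (X : choiceType) := Distr {
  dfun :> X -> R;
  dfun_ge0 : forall x, 0 <= dfun x;
  dfun_sum1 : (\esum_(x in [set: X]) (dfun x)%:E = 1)%E }.

Definition is_dirac (R : realType) (X : choiceType) (d : distr R X) :=
  exists x, forall y, d y = (y == x)%:R.

Lemma distr_inhabited (R : realType) (X : choiceType) (d : distr R X) :
  exists x, d x != 0.
Proof.
apply: contrapT => d0; have := dfun_sum1 d; rewrite esum1.
  by move/eqP; rewrite eqe eq_sym oner_eq0.
move=> x _; congr EFin; apply/eqP/negPn/negP => dx.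
by apply: d0; exists x.
Qed.

Record mdp (R : realType) := MDP {
  state : finType;
  action : finType;
  Av : state -> {set action};
  Av_neq0 : forall s, Av s != finset.set0;
  Av_partition : forall a, exists! s, a \in Av s;
  Delta : action -> distr R state;
  s0 : state }.

Record strategy (R : realType) (M : mdp R) := Strategy {
  memory : countType;
  update : action M -> state M -> memory -> distr R memory;
  next : state M -> memory -> distr R (action M);
  next_Av : forall s m a, next s m a != 0 -> a \in Av s;
  initial : distr R memory }.

Arguments update {R M} sigma a t m : rename.
Arguments next {R M} sigma s m : rename.

Definition deterministic_memoryless (R : realType) (M : mdp R)
    (sigma : strategy M) :=
  (exists m0 : memory sigma, forall m, m = m0) /\
  (forall s m, is_dirac (next sigma s m)).

Section Runs.
Variables (R : realType) (M : mdp R) (sigma : strategy M).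

(* A strategy turns the MDP into a Markov chain on triples (s, m, a): current
   state, current memory element, and the action about to be played. *)
Definition config : Type := (state M * memory sigma * action M)%type.

HB.instance Definition _ := Countable.on config.

Definition config_state (x : config) : state M := x.1.1.

Definition init_prob (x : config) : R :=
  let: (s, m, a) := x in
  (s == s0 M)%:R * initial sigma m * next sigma s m a.

Definition step_prob (x y : config) : R :=
  let: (s, m, a) := x in let: (t, m', b) := y in
  Delta a t * update sigma a t m m' * next sigma t m' b.

Definition run : Type := nat -> config.

Lemma config_inhabited : exists _ : config, True.
Proof.
have [m _] := distr_inhabited (initial sigma).
have /set0Pn[a _] := Av_neq0 (s0 M).
by exists (s0 M, m, a).
Qed.

Definition config0 : config := projT1 (cid config_inhabited).

HB.instance Definition _ := Choice.on run.
HB.instance Definition _ := isPointed.Build run (fun=> config0).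

Definition cylinder (w : run) (n : nat) : set run :=
  [set rho | forall i, (i <= n)%N -> rho i = w i].

Definition cylinders : set (set run) :=
  [set C | exists w n, C = cylinder w n].

Definition run_space := g_sigma_algebraType cylinders.

(* P is the measure on runs induced by the strategy; it is determined by its
   values on cylinders, so this relation defines the usual P^sigma. *)
Definition induced_measure (P : probability run_space R) :=
  forall (w : run) (n : nat),
    P (cylinder w n) =
    (init_prob (w 0) * \prod_(i < n) step_prob (w i) (w i.+1))%:E.

Lemma measurable_coord (i : nat) (Q : set config) :
  measurable ([set rho | Q (rho i)] : set run_space).
Proof.
rewrite (_ : [set rho | _] = \bigcup_(l : seq config)
    (if `[< Q (nth config0 l i) >] then cylinder (nth config0 l) i else set0)).
  apply: countable_bigcupT_measurable.
    exact: countableP.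
  move=> l; case: ifPn => // _; apply: sub_sigma_algebra.
  by exists (nth config0 l), i.
apply/seteqP; split=> [rho /= Qi|rho [l _]].
  exists (mkseq rho i.+1) => //.
  rewrite nth_mkseq// (asboolT Qi) => j ji; by rewrite nth_mkseq.
by case: ifPn => // /asboolP Ql /(_ i (leqnn i)) /= ->.
Qed.

End Runs.

(* Both objectives carry a rational reward; the reward of [WReach T r] is only
   ever read on the target set T. *)
Inductive objective (R : realType) (M : mdp R) :=
| WReach of {set state M} & (state M -> rat)
| MeanPayoff of (state M -> rat).

Definition absorbing (R : realType) (M : mdp R) (T : {set state M}) :=
  forall t a, t \in T -> a \in Av t -> Delta a t = 1.

Definition wf_objective (R : realType) (M : mdp R) (obj : objective M) :=
  match obj with
  | WReach T _ => absorbing T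
  | MeanPayoff _ => True
  end.

Section Payoff.
Variables (R : realType) (M : mdp R).

Definition wreach_payoff (T : {set state M}) (r : state M -> rat)
    (rho : nat -> state M) : R :=
  match pselect (exists n, rho n \in T) with
  | left reached => ratr (r (rho (ex_minn reached)))
  | right _ => 0
  end.

(* Runs are indexed from 0 here. The averages are bounded by max |r|, so the
   extended-real liminf is finite and [fine] loses nothing. *)
Definition mean_payoff (r : state M -> rat) (rho : nat -> state M) : R :=
  fine (limn_einf (fun n : nat => (n%:R^-1 * \sum_(i < n) ratr (r (rho i)))%:E)).

Definition payoff (obj : objective M) : (nat -> state M) -> R :=
  match obj with
  | WReach T r => wreach_payoff T r
  | MeanPayoff r => mean_payoff r
  end.

Variable sigma : strategy M.

Definition run_payoff (obj : objective M) (rho : run_space sigma) : R :=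
  payoff obj (fun i => config_state (rho i)).

Lemma measurable_run_payoff obj : measurable_fun [set: run_space sigma] (run_payoff obj).
Proof.
case: obj => [T r|r]; rewrite /run_payoff /=.
  move=> _ B mB; rewrite setTI.
  pose st (rho : run_space sigma) i := config_state (rho i).
  pose hit n : set (run_space sigma) := [set rho | st rho n \in T].
  rewrite (_ : _ @^-1` B =
    (\bigcup_n ([set rho | st rho n \in T /\ B (ratr (r (st rho n)))] `&`
                \bigcap_(i < n) ~` hit i)) `|`
    (\bigcap_n ~` hit n `&` [set _ | B 0])); last first.
    apply/seteqP; split=> rho /=; rewrite /wreach_payoff.
      case: pselect => [h|nh B0].
        case: ex_minnP => n nT nmin Br; left; exists n => //; split=> // i /= ilt.
        by move=> /nmin; rewrite leqNgt ilt.
      by right; split=> // n _ hn; apply: nh; exists n.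
    case: pselect => [h|nh].
      case: ex_minnP => n nT nmin [[k _ [[kT Bk] kmin]]|[hit0 _]].
        suff -> : n = k by [].
        apply/eqP; rewrite eqn_leq (nmin _ kT) leqNgt.
        by apply/negP => /kmin; apply.
      by have := hit0 n I.
    by case=> [[k _ [[kT _] _]]|[]//]; case: nh; exists k.
  apply: measurableU.
    apply: bigcup_measurable => n _; apply: measurableI.
      exact: (measurable_coord n [set x | config_state x \in T /\
        B (ratr (r (config_state x)))]).
    apply: bigcap_measurableType => i _; apply: measurableC.
    exact: (measurable_coord i [set x | config_state x \in T]).
  apply: measurableI.
    apply: bigcap_measurableType => i _; apply: measurableC.
    exact: (measurable_coord i [set x | config_state x \in T]).
  have [B0|B0] := pselect (B 0).
    by rewrite (_ : [set _ | _] = setT)//; apply/seteqP; split.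
  by rewrite (_ : [set _ | _] = set0)//; apply/seteqP; split.
pose avg (n : nat) (rho : run_space sigma) : \bar R :=
  (n%:R^-1 * \sum_(i < n) ratr (r (config_state (rho i))))%:E.
have mavg n : measurable_fun [set: run_space sigma] (avg n).
  apply/measurable_EFinP; apply: measurable_funM => //.
  apply: measurable_sum => i _ B mB; rewrite setTI.
  exact: (measurable_coord i [set x | B (ratr (r (config_state x)))]).
have mliminf : measurable_fun [set: run_space sigma] (fun rho : run_space sigma => limn_einf (avg ^~ rho)).
  apply: measurableT_comp => //; apply: measurable_fun_limn_esup => n.
  exact: measurableT_comp.
exact: (measurableT_comp (fine_measurable measurableT) mliminf).
Qed.

HB.instance Definition _ obj :=
  isMeasurableFun.Build _ _ _ _ (run_payoff obj) (measurable_run_payoff obj).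

End Payoff.

Section Risk.
Local Open Scope ereal_scope.
Context d (T : measurableType d) (R : realType).
Variables (P : probability T R) (X : {RV P >-> R}) (p : R).

Definition VaR : R := sup [set r : R | cdf X r <= p%:E].

Definition CVaR : \bar R :=
  (p^-1)%:E * (\int[distribution P X]_(x in `]-oo, VaR[) x%:E
               + (p%:E - P [set w | (X w < VaR)%R]) * VaR%:E).

End Risk.

Inductive criterion := Crit_E | Crit_CVaR | Crit_VaR.

Definition criterion_code (k : criterion) : 'I_3 :=
  match k with Crit_E => inord 0 | Crit_CVaR => inord 1 | Crit_VaR => inord 2 end.
Definition criterion_decode (i : 'I_3) : criterion :=
  match val i with 0 => Crit_E | 1 => Crit_CVaR | _ => Crit_VaR end%N.
Lemma criterion_codeK : cancel criterion_code criterion_decode.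
Proof. by case; rewrite /criterion_decode /= inordK. Qed.
HB.instance Definition _ := Finite.copy criterion (can_type criterion_codeK).

Inductive constraint (R : realType) :=
| ExpGe (e : R)
| CVaRGe (p c : R)
| VaRGe (q v : R).

Definition criterion_of (R : realType) (c : constraint R) : criterion :=
  match c with
  | ExpGe _ => Crit_E | CVaRGe _ _ => Crit_CVaR | VaRGe _ _ => Crit_VaR
  end.

Definition wf_constraint (R : realType) (c : constraint R) :=
  match c with
  | ExpGe _ => true
  | CVaRGe p _ => 0 < p < 1
  | VaRGe q _ => 0 < q < 1
  end.

Definition holds d (T : measurableType d) (R : realType) (P : probability T R)
    (X : {RV P >-> R}) (c : constraint R) :=
  match c with
  | ExpGe e => (e%:E <= 'E_P[X])%E
  | CVaRGe p c => (c%:E <= CVaR X p)%E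
  | VaRGe q v => v <= VaR X q
  end.

Definition satisfies (R : realType) (M : mdp R) (sigma : strategy M)
    (obj : objective M) (c : constraint R) :=
  exists P : probability (run_space sigma) R,
    induced_measure P /\ holds (run_payoff obj : {RV P >-> R}) c.

(* Main.v *)
Require Import Defs.
From mathcomp Require Import all_boot all_order all_algebra.
From mathcomp Require Import all_classical all_reals all_analysis.
From mathcomp Require Import measurable_realfun ring lra.

(* For a nondecreasing [f], deterministic memoryless strategies maximize
   E[f(mean payoff)]: writing [w(s)] for the best mean payoff that can be secured
   almost surely from [s], discounted values of the reward provide potentials
   showing that the mean payoff of almost every run is at most the largest
   [w(s)] among the states it visits infinitely often, while a single
   memoryless policy secures [w(s)] from every [s]. Maximizing E[f(mean payoff)]
   is therefore an optimal stopping problem with reward [f(w(s))], whose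
   discounted versions are solved by memoryless policies. Weighted reachability
   is almost surely a mean payoff. Each constraint has the form
   E[f(X)] >= const: [f] is the identity for expectation, [x |-> 1_(v <= x)] for
   VaR, and [x |-> min(x - v, 0)] for CVaR, where VaR is the maximizer of
   [v |-> p v + E min(X - v, 0)]. *)

Set Implicit Arguments.
Unset Strict Implicit.
Unset Printing Implicit Defensive.

Import Order.TTheory GRing.Theory Num.Theory.
Import numFieldNormedType.Exports.

Local Open Scope classical_set_scope.
Local Open Scope ring_scope.

(** * Averages, fixed points and limits *)

(** The given strategy may randomize and use unbounded memory, so the visited states need not form a
    Markov chain and no ergodic theorem applies to them. Upper bounds therefore rest on inequalities
    valid for every available action: approximate potentials [h] control averages of the reward, and
    excessive functions [V] control expectations of the outcome. Applied to the actions of one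
    policy, the same tools give the lower bounds. Potentials may grow as the discount tends to 1, so
    each error [eps] gets its own [h]; the exponential moment bound on averages accepts any finite
    bound on [h], whatever its size. The optimal policy is not read off from a limit equation. It is
    the best of the finitely many memoryless policies: every discounted stopping value is at most
    its payoff, hence so is the limit of these values at the initial state, and this limit bounds
    the payoff of every strategy. Limits are taken along an ultrafilter, so that the values of all
    states, and the greedy policy with them, converge together. *)

Section Mean.
Variables (R : realType) (X : finType) (p : distr R X).
Implicit Types v : X -> R.

Definition mean v : R := \sum_x p x * v x.

Lemma sum_distr : \sum_x p x = 1.
Proof.
have eX : [set: X] = [set` index_enum X].
  by apply/seteqP; split=> x //= _; rewrite mem_index_enum.
have := dfun_sum1 p; rewrite eX esum_fset.
- by rewrite -fsbig_seq ?index_enum_uniq// sumEFin => -[].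
- exact: finite_seq.
- by move=> x _; rewrite lee_fin dfun_ge0.
Qed.

Lemma meanD v1 v2 : mean (fun x => v1 x + v2 x) = mean v1 + mean v2.
Proof. by rewrite /mean -big_split; apply: eq_bigr => x _ /=; rewrite mulrDr. Qed.

Lemma meanZ k v : mean (fun x => k * v x) = k * mean v.
Proof. by rewrite /mean mulr_sumr; apply: eq_bigr => x _; rewrite mulrCA. Qed.

Lemma mean_cst k : mean (fun=> k) = k.
Proof. by rewrite /mean -mulr_suml sum_distr mul1r. Qed.

Lemma mean_affine k c v : mean (fun x => k + c * v x) = k + c * mean v.
Proof. by rewrite (meanD (fun=> k)) mean_cst meanZ. Qed.

Lemma meanN v : mean (fun x => - v x) = - mean v.
Proof. by rewrite -mulN1r -meanZ; apply: eq_bigr => x _; rewrite mulN1r. Qed.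

Lemma meanB v1 v2 : mean (fun x => v1 x - v2 x) = mean v1 - mean v2.
Proof. by rewrite meanD meanN. Qed.

Lemma le_mean_supp v1 v2 : (forall x, p x != 0 -> v1 x <= v2 x) ->
  mean v1 <= mean v2.
Proof.
move=> v12; apply: ler_sum => x _; have [->|px] := eqVneq (p x) 0.
  by rewrite !mul0r.
by apply: ler_wpM2l; [exact: dfun_ge0|exact: v12].
Qed.

Lemma le_mean v1 v2 : (forall x, v1 x <= v2 x) -> mean v1 <= mean v2.
Proof. by move=> v12; apply: le_mean_supp => x _. Qed.

Lemma mean_le v c : (forall x, p x != 0 -> v x <= c) -> mean v <= c.
Proof. by move=> vc; rewrite -[leRHS]mean_cst; apply: le_mean_supp. Qed.

Lemma mean_ge v c : (forall x, p x != 0 -> c <= v x) -> c <= mean v.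
Proof. by move=> vc; rewrite -[leLHS]mean_cst; apply: le_mean_supp. Qed.

(** Nonnegative terms [p x * (c - v x)] with sum 0 all vanish. This is the maximum principle that
    closes sets of maximizers under transitions. *)
Lemma mean_eq_ub v c : (forall x, v x <= c) -> mean v = c ->
  forall x, p x != 0 -> v x = c.
Proof.
move=> vc mc x px; apply/eqP; rewrite -subr_eq0 -oppr_eq0 opprB.
have : mean (fun x => c - v x) = 0 by rewrite meanB mean_cst mc subrr.
move=> /psumr_eq0P => /(_ (fun y _ => mulr_ge0 (dfun_ge0 p y) _)) H.
have /eqP := H (fun y => ltac:(by rewrite subr_ge0)) x isT.
by rewrite mulf_eq0 (negbTE px).
Qed.

End Mean.

Section Tarski.
Variables (R : realType) (X : Type) (lo hi : R) (T : (X -> R) -> X -> R).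
Hypothesis lohi : lo <= hi.
Hypothesis T_lo : forall x, lo <= T (fun=> lo) x.
Hypothesis T_hi : forall x, T (fun=> hi) x <= hi.
Hypothesis T_mono : forall u v, (forall x, u x <= v x) -> forall x, T u x <= T v x.

(** Knaster-Tarski: the pointwise infimum of the functions with [T u <= u] is a fixed point. Bellman
    operators are monotone, so no contraction argument is needed. *)
Lemma tarski : exists v, (forall x, lo <= v x <= hi) /\ (forall x, v x = T v x).
Proof.
pose Z := [set u : X -> R | (forall x, lo <= u x) /\ (forall x, T u x <= u x)].
pose v x := inf [set u x | u in Z].
have Zhi : Z (fun=> hi) by split.
have Zinf x : has_inf [set u x | u in Z].
  split; first by exists hi, (fun=> hi).
  by exists lo => _ [u [ulo _] <-].
have v_le u x : Z u -> v x <= u x.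
  by move=> Zu; apply: ge_inf; [exact: (Zinf x).2|exists u].
have v_ge x c : (forall u, Z u -> c <= u x) -> c <= v x.
  by move=> cu; apply: lb_le_inf; [exact: (Zinf x).1|move=> _ [u Zu <-]; exact: cu].
have lov x : lo <= v x by apply: v_ge => u [].
have Tv x : T v x <= v x.
  apply: v_ge => u Zu; apply: le_trans (Zu.2 x).
  by apply: T_mono => y; apply: v_le.
exists v; split=> [x|x]; first by rewrite lov v_le.
apply/eqP; rewrite eq_le Tv andbT; apply: v_le; split=> [y|y]; last exact: T_mono.
by apply: (le_trans (T_lo y)); apply: T_mono.
Qed.

End Tarski.

Section FiniteBounds.
Variables (R : realType) (X : finType).

Lemma fin_bound (u : X -> R) : exists B : R, 0 < B /\ forall x, `|u x| <= B.
Proof.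
exists (1 + \sum_x `|u x|); split=> [|x].
  by rewrite ltr_pwDl// sumr_ge0.
by rewrite (bigD1 x)//= ler_wpDl// lerDl sumr_ge0.
Qed.

Lemma fin_pos_lb (u : X -> R) : (forall x, 0 < u x) ->
  exists m : R, 0 < m /\ forall x, m <= u x.
Proof.
move=> u0; have [B [B0 uB]] := fin_bound (fun x => (u x)^-1).
exists B^-1; split=> [|x]; first by rewrite invr_gt0.
rewrite -[leRHS]invrK lef_pV2 ?posrE ?invr_gt0//.
by rewrite (le_trans _ (uB x))// ler_norm.
Qed.

Lemma fin_argmax (u : X -> R) (x0 : X) : exists x, forall y, u y <= u x.
Proof.
by case: (arg_maxP u (i0 := x0) (P := xpredT)) => // x _ ux; exists x => y; exact: ux.
Qed.

End FiniteBounds.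

Section Ultra.
Variables (G : set_system nat) (GU : UltraFilter G).

(** A bounded sequence has a cluster point by compactness, and an ultrafilter converges to each of
    its cluster points. One [G] serves all states at once, with no extraction of subsequences. *)
Lemma ultra_cvg (R : realType) (u : nat -> R) B : (forall k, `|u k| <= B) ->
  exists l : R, u k @[k --> G] --> l.
Proof.
move=> uB; have [|p [_ cp]] := @segment_compact R (- B) B (u @ G) _.
  by apply: nearW => k /=; rewrite in_itv/= -ler_norml.
exists p => N pN.
have [//|GN] := in_ultra_setVsetC (u @^-1` N) GU.
by have [y [/= nNy Ny]] := cp (~` N) N GN pN.
Qed.

(** Pigeonhole along [G]: finitely many sets that cover [nat] cannot all have their complements in
    [G]. *)
Lemma ultra_const (X : finType) (f : nat -> X) : exists x, G [set k | f k = x].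
Proof.
apply: contrapT => nf.
have nG x : G [set k | f k <> x].
  by have [h|//] := in_ultra_setVsetC [set k | f k = x] GU; case: nf; exists x.
by have [k /(_ (f k))] := filter_ex (filter_forall _ nG); apply.
Qed.

End Ultra.
(** * Secured values and potentials *)

Section Values.
Variables (R : realType) (M : mdp R) (r : state M -> R).
Local Notation S := (state M).
Local Notation A := (action M).
Implicit Types (s t : S) (a : A) (C : {set S}) (d : {ffun S -> A}).
Implicit Types (lam e : R) (h v : S -> R).

Lemma Av_ex s : exists a, a \in Av s.
Proof. exact/finset.set0Pn/Av_neq0. Qed.

Definition act0 s : A := projT1 (cid (Av_ex s)).

Lemma act0_Av s : act0 s \in Av s.
Proof. by rewrite /act0; case: cid. Qed.

Definition greedy v s : A :=
  [arg max_(a > act0 s in Av s) mean (Delta a) v]%O.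

Lemma greedy_Av v s : greedy v s \in Av s.
Proof. by rewrite /greedy; case: arg_maxP => //; exact: act0_Av. Qed.

Lemma greedy_max v s a : a \in Av s ->
  mean (Delta a) v <= mean (Delta (greedy v s)) v.
Proof.
move=> aA; rewrite /greedy; case: arg_maxP => [|g _]; first exact: act0_Av.
exact.
Qed.

Lemma greedy_mono v1 v2 s : (forall t, v1 t <= v2 t) ->
  mean (Delta (greedy v1 s)) v1 <= mean (Delta (greedy v2 s)) v2.
Proof.
move=> v12; apply: (le_trans (le_mean _ v12)); exact/greedy_max/greedy_Av.
Qed.

(** [h] is an approximate subsolution of the Poisson equation on the closed set [C], which keeps the
    long run average of [r] above [lam - e]. A separate [h] for each [e] makes the notion stable
    under limits in [lam]. *)
Definition good C d lam :=
  (forall s, s \in C -> d s \in Av s /\ forall t, Delta (d s) t != 0 -> t \in C) /\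
  forall e, 0 < e -> exists h, forall s, s \in C ->
    lam - e <= r s + mean (Delta (d s)) h - h s.

Lemma good_le C d lam1 lam2 : lam1 <= lam2 -> good C d lam2 -> good C d lam1.
Proof.
move=> l12 [Cd Ch]; split=> // e e0; have [h hh] := Ch e e0.
by exists h => s sC; apply: le_trans (hh s sC); rewrite lerD2r.
Qed.

Lemma good_lim C d lam : (forall e, 0 < e -> good C d (lam - e)) -> good C d lam.
Proof.
move=> Cd; split; first exact: (Cd 1 ltr01).1.
move=> e e0; have e20 : 0 < e / 2 by rewrite divr_gt0.
have [h hh] := (Cd _ e20).2 _ e20.
by exists h => s /hh; rewrite -addrA -opprD -splitr.
Qed.

Lemma good_setU C1 d1 C2 d2 lam : good C1 d1 lam -> good C2 d2 lam ->
  good (C1 :|: C2) [ffun s => if s \in C1 then d1 s else d2 s] lam.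
Proof.
move=> [Cd1 Ch1] [Cd2 Ch2]; split=> [s|e e0].
  rewrite finset.in_setU ffunE; case: ifPn => [sC _|_ /= sC].
    have [? sub] := Cd1 s sC; split=> // t /sub tC; by rewrite finset.in_setU tC.
  have [? sub] := Cd2 s sC; split=> // t /sub tC.
  by rewrite finset.in_setU tC orbT.
have [h1 hh1] := Ch1 e e0; have [h2 hh2] := Ch2 e e0.
(* Raising [h1] by [K] puts [h] above [h2] on [C1], so a move from [C2] into [C1] only helps; inside
   the closed set [C1] the shift cancels. *)
have [K [_ hK]] := fin_bound (fun s => h2 s - h1 s).
pose h s := if s \in C1 then h1 s + K else h2 s.
exists h => s; rewrite finset.in_setU ffunE.
case: ifPn => [sC _|sC1 /= sC].
  rewrite {2}/h sC.
  have -> : mean (Delta (d1 s)) h = mean (Delta (d1 s)) h1 + K.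
    rewrite -[X in _ + X](mean_cst (Delta (d1 s))) -meanD; apply/eqP.
    by rewrite eq_le; apply/andP; split; apply: le_mean_supp => t /(Cd1 s sC).2 tC;
       rewrite /h tC.
  by rewrite addrA opprD addrACA subrr addr0 hh1.
rewrite {2}/h (negbTE sC1); apply: le_trans (hh2 s sC) _.
rewrite lerD2r lerD2l; apply: le_mean => t; rewrite /h; case: ifPn => // _.
by rewrite -lerBlDl (le_trans _ (hK t))// ler_norm.
Qed.

Lemma good_ub C d lam s B : s \in C -> good C d lam -> (forall t, r t <= B) -> lam <= B.
Proof.
move=> sC [Cd Ch] rB; apply/ler_addgt0Pr => e e0.
have [h hh] := Ch e e0; rewrite -lerBlDr.
(* Where [h] is largest on the closed set [C], its drift is at most 0, which leaves
   [lam - e <= r t]. *)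
pose t := [arg max_(t > s in C) h t]%O.
have [tC tmax] : t \in C /\ forall t', t' \in C -> h t' <= h t.
  by rewrite /t; case: arg_maxP.
apply: (le_trans (hh t tC)); rewrite -addrA; apply: ler_wnDr => //.
by rewrite subr_le0; apply: mean_le => t' /(Cd t tC).2; exact: tmax.
Qed.

Lemma good_setT B : (forall t, B <= r t) -> good [set: S]%SET [ffun s => act0 s] B.
Proof.
move=> rB; split=> [s _|e e0]; first by rewrite ffunE act0_Av.
exists (fun=> 0) => s _; rewrite mean_cst subr0 addr0.
by rewrite (le_trans _ (rB s))// gerBl ltW.
Qed.

Lemma value_ex s : exists lam, (exists C d, s \in C /\ good C d lam) /\
  forall C d mu, s \in C -> good C d mu -> mu <= lam.
Proof.
have [B [_ rB]] := fin_bound r.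
pose Z := [set lam | exists C d, s \in C /\ good C d lam].
have supZ : has_sup Z.
  split.
    exists (- B), [set: S]%SET, [ffun s => act0 s]; split; first by rewrite finset.in_setT.
    by apply: good_setT => t; have := rB t; rewrite ler_norml => /andP[].
  exists B => lam [C [d [sC Cd]]]; apply: (good_ub sC Cd) => t.
  by rewrite (le_trans _ (rB t))// ler_norm.
exists (sup Z); split; last first.
  by move=> C d mu sC Cd; apply: (sup_ubound supZ.2); exists C, d.
apply: contrapT => nex.
(* The supremum is attained because there are finitely many pairs: if each one missed [sup Z] by
   some margin [e], the least margin would keep [Z] away from its supremum. *)
pose P (p : {set S} * {ffun S -> A}) e :=
  0 < e /\ (s \in p.1 -> ~ good p.1 p.2 (sup Z - e)).
have /choice[e Pe] : forall p, exists e, P p e.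
  move=> p; apply: contrapT => nP; have [sp|sp] := boolP (s \in p.1); last first.
    by apply: nP; exists 1; split => // sp'; rewrite sp' in sp.
  apply: nex; exists p.1, p.2; split=> //; apply: good_lim => e e0.
  by apply: contrapT => ng; apply: nP; exists e.
have [m [m0 me]] := fin_pos_lb (fun p => (Pe p).1).
have [lam [C [d [sC Cd]]] lamZ] := sup_adherent m0 supZ.
apply: (Pe (C, d)).2 => //; apply: good_le Cd.
by rewrite (le_trans _ (ltW lamZ))// lerB.
Qed.

(* The best mean payoff that can be secured almost surely from [s]. *)
Definition value s : R := projT1 (cid (value_ex s)).

Lemma value_good s : exists C d, s \in C /\ good C d (value s).
Proof. by rewrite /value; case: cid => ? []. Qed.

Lemma good_value C d lam s : s \in C -> good C d lam -> lam <= value s.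
Proof. by rewrite /value; case: cid => ? [] /= _ H; exact: H. Qed.

Lemma value_ge B s : (forall t, B <= r t) -> B <= value s.
Proof. by move=> /good_setT; apply: good_value; rewrite finset.in_setT. Qed.

(** The witnesses of all states of value at least [lam] are glued one by one with [good_setU]; by
    [good_value] the union contains no other state. *)
Lemma level_good lam : exists C d, good C d lam /\ forall s, s \in C = (lam <= value s).
Proof.
have [C [d [Cd sC]]] : exists C d, good C d lam /\
    forall s, s \in enum S -> lam <= value s -> s \in C.
  elim: (enum S) => [|s l [C [d [Cd lC]]]].
    by exists finset.set0, [ffun s => act0 s]; split=> //; split=> [s|e e0];
       [|exists (fun=> 0) => s]; rewrite finset.in_set0.
  have [ls|ls] := leP lam (value s); last first.
    exists C, d; split=> // t; rewrite inE => /predU1P[->|]; last exact: lC.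
    by rewrite leNgt ls.
  have [C' [d' [sC' Cd']]] := value_good s.
  exists (C :|: C'), [ffun s => if s \in C then d s else d' s]; split.
    by apply: good_setU => //; exact: good_le Cd'.
  move=> t; rewrite inE finset.in_setU => /predU1P[->|/lC tC /tC ->//].
  by rewrite sC' orbT.
exists C, d; split=> // s; apply/idP/idP => [sC'|]; first exact: good_value Cd.
by apply: sC; rewrite mem_enum.
Qed.

(* A single memoryless policy: in a state of value [lam] follow a policy that
   secures [lam]; the value can then only increase along the run. *)
Lemma secure_policy : exists e : S -> A, [/\ forall s, e s \in Av s,
  forall s t, Delta (e s) t != 0 -> value s <= value t &
  forall lam eps, 0 < eps -> exists h, forall s, value s = lam ->
    lam - eps <= r s + mean (Delta (e s)) h - h s].
Proof.
have /choice[p Pp] : forall lam, exists p : {set S} * {ffun S -> A},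
    good p.1 p.2 lam /\ forall s, s \in p.1 = (lam <= value s).
  by move=> lam; have [C [d ?]] := level_good lam; exists (C, d).
exists (fun s => (p (value s)).2 s); split=> [s|s t|lam eps eps0].
- by have [[+ _] sC] := Pp (value s) => /(_ s); rewrite sC lexx => /(_ isT)[].
- have [[+ _] sC] := Pp (value s) => /(_ s); rewrite sC lexx => /(_ isT)[_] /[apply].
  by rewrite sC.
- have [[_ /(_ _ eps0)[h hh]] sC] := Pp lam; exists h => s sl.
  by rewrite sl; apply: hh; rewrite sC sl.
Qed.

End Values.

(** * Vanishing discount and the upper certificate *)

Section Discounting.
Variables (R : realType) (M : mdp R) (r : state M -> R).
Local Notation S := (state M).
Local Notation A := (action M).
Implicit Types (s t : S) (a : A).

Lemma mean_cvg (G : set_system nat) {FG : Filter G} (X : finType) (p : distr R X)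
    (v : nat -> X -> R) (g : X -> R) : (forall x, v k x @[k --> G] --> g x) ->
  mean p (v k) @[k --> G] --> mean p g.
Proof.
move=> vg; apply: (cvg_big add_continuous) => // x _.
by apply: cvgM => //; exact: cvg_cst.
Qed.

(** States outside [U] get the worst value [- B], so that a limit value above [- B] has to come from
    play inside [U]. The weight [1 - b] normalizes the values into [[- B, B]] for every discount. *)
Lemma discounted (U : pred S) (B b : R) : (forall s, `|r s| <= B) -> 0 <= b <= 1 ->
  exists v : S -> R, (forall s, - B <= v s <= B) /\ forall s,
    v s = if U s then (1 - b) * r s + b * mean (Delta (greedy v s)) v else - B.
Proof.
move=> rB /andP[b0 b1].
apply: tarski => [|s|s|v1 v2 v12 s].
- by have := le_trans (normr_ge0 _) (rB (s0 M)); lra.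
- rewrite mean_cst; case: ifP => // _; have := rB s; rewrite ler_norml => /andP[rs _].
  have : 0 <= (1 - b) * (r s + B) by rewrite mulr_ge0// ?subr_ge0// -lerBlDr sub0r.
  lra.
- rewrite mean_cst; have := rB s; rewrite ler_norml => /andP[_ rs].
  case: ifP => _; last by have := normr_ge0 (r s); have := rB s; lra.
  have : 0 <= (1 - b) * (B - r s) by rewrite mulr_ge0// subr_ge0.
  lra.
- by case: ifP => // _; rewrite lerD2l ler_wpM2l// greedy_mono.
Qed.

(* If the discounted values stayed above [lam + eps] as the discount tends to
   1, the states maximizing their limit would form a closed set of value at
   least [lam + eps] inside [value <= lam]. Otherwise the rescaled discounted
   values are a certificate. *)
Lemma upper_certificate (lam eps : R) : 0 < eps -> exists h : S -> R,
  forall s a, a \in Av s -> value r s <= lam ->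
    r s + mean (Delta a) h - h s <= lam + eps.
Proof.
move=> eps0; have [B [B0 rB]] := fin_bound r.
have rB1 t : - B <= r t by have := rB t; rewrite ler_norml => /andP[].
(* Below [- B] no state has value at most [lam], so any [h] works. Otherwise the penalty [- B] is at
   most [lam], which [maxU] relies on. *)
have [lamB|Blam] := ltP lam (- B).
  exists (fun=> 0) => s a _; rewrite leNgt (lt_le_trans lamB)//.
  exact: value_ge.
(* [q k] is the expected horizon of the discount [b k]: multiplied by it, the normalized value
   becomes the total discounted reward, the usual candidate for a potential. *)
pose q k : R := k.+1%:R; pose b k : R := 1 - (q k)^-1.
have q0 k : 0 < q k by rewrite ltr0n.
have b01 k : 0 <= b k <= 1.
  by rewrite subr_ge0 gerBl invf_le1// ler1n/= invr_ge0 ltW.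
have [v vP] := choice (fun k => discounted (fun s => value r s <= lam) rB (b01 k)).
have vE k s : value r s <= lam -> forall m, m = mean (Delta (greedy (v k) s)) (v k) ->
    q k * v k s = r s + (q k - 1) * m.
  move=> sU m ->; rewrite (vP k).2 sU /b mulrDr !mulrA.
  have qk : q k != 0 by rewrite gt_eqF.
  by congr (_ + _); rewrite ?(mulrBr, opprD, opprK, addrA) ?mulr1 ?subrr ?add0r mulfV ?mul1r.
apply: contrapT => nex.
have /choice[t vt] : forall k, exists t, lam + eps < v k t.
  (* With this [h] the left side is [q k * (mean (Delta a) (v k) - m) + m], at most [m] because the
     greedy action maximizes the mean. *)
  move=> k; apply: contrapT => nt; apply: nex; exists (fun s => q k * v k s) => s a aA sU.
  rewrite meanZ (vE _ _ sU _ erefl); set m := mean (Delta (greedy _ _)) _.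
  have ma : mean (Delta a) (v k) <= m by exact: greedy_max.
  have ml : m <= lam + eps.
    by apply: mean_le => t _; rewrite leNgt; apply/negP => vt; apply: nt; exists t.
  have : q k * mean (Delta a) (v k) <= q k * m by rewrite ler_pM2l.
  lra.
have [G [GU ooG]] := ultraFilterLemma (eventually_filter).
have /choice[g vg] : (forall s, exists l : R, v k s @[k --> G] --> l).
  by move=> s; apply: (@ultra_cvg G GU R _ B) => k; rewrite ler_norml (vP k).1.
have [t0 Gt0] := ultra_const GU t.
have [d Gd] := ultra_const GU (fun k => [ffun s => greedy (v k) s]).
(* The reward term has weight [(q k)^-1] and disappears in the limit, so [g] is harmonic under [d]
   on the states of value at most [lam]. *)
have gd s : value r s <= lam -> g s = mean (Delta (d s)) g.
  move=> sU.
  have lim1 : (q k)^-1 * r s + b k * mean (Delta (d s)) (v k) @[k --> G] -->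
      0 * r s + (1 - 0) * mean (Delta (d s)) g.
    have q'0 : (q k)^-1 @[k --> G] --> (0 : R).
      by move=> N /cvg_harmonic; exact: ooG.
    apply: cvgD; first exact: cvgMl.
    by apply: cvgM; [apply: cvgB => //; exact: cvg_cst|exact: mean_cvg].
  have : v k s @[k --> G] --> 0 * r s + (1 - 0) * mean (Delta (d s)) g.
    apply: cvg_trans lim1; apply: near_eq_cvg; near=> k.
    have <- : [ffun s => greedy (v k) s] = d by near: k.
    by rewrite ffunE (vP k).2 sU /b subKr.
  rewrite mul0r add0r subr0 mul1r.
  by apply: (cvg_unique (@norm_hausdorff _ R) (vg s)).
have gB s : lam < value r s -> g s = - B.
  move=> sU; apply: (cvg_unique (@norm_hausdorff _ R) (vg s)).
  rewrite (_ : v ^~ s = fun=> - B); first exact: cvg_cst.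
  by apply/funext => k; rewrite (vP k).2 leNgt sU.
have gt0 : lam + eps <= g t0.
  apply: (cvgr_to_ge (vg t0)).
  near=> k.
  have <- : t k = t0 by near: k.
  exact/ltW/vt.
have [s1 s1max] := fin_argmax g t0.
have s1lam : lam < g s1.
  by rewrite (lt_le_trans _ (s1max t0))// (lt_le_trans _ gt0)// ltrDl.
have maxU s : g s = g s1 -> value r s <= lam.
  by move=> sm; rewrite leNgt; apply/negP => /gB; lra.
(* By the maximum principle the maximizers of [g] are closed under [d]; they have value at most
   [lam], since elsewhere [g] is [- B <= lam < g s1]. *)
have : good r [set s | g s == g s1]%SET d (g s1).
  split=> [s|e e0].
    rewrite finset.inE => /eqP sm; split.
      have [k <-] := filter_ex Gd; rewrite ffunE; exact: greedy_Av.
    move=> t' /(mean_eq_ub s1max) H; rewrite finset.inE H//.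
    by rewrite -gd ?maxU.
  have : \forall k \near G, forall s, g s = g s1 -> g s1 - e < mean (Delta (d s)) (v k).
    apply: filter_forall => s.
    have [gs|gs] := pselect (g s = g s1); last by near=> k.
    near=> k => _; near: k.
    apply: (cvgr_gt (mean (Delta (d s)) g)); first exact: mean_cvg.
    by rewrite -gd ?maxU// gs gtrBl.
  move=> /(filterI Gd)/filter_ex[k [/= dk kP]].
  (* For this [k] the greedy policy is [d], and the drift of the potential, reward included, is
     exactly [mean (Delta (d s)) (v k)]. *)
  exists (fun s => q k * v k s) => s; rewrite finset.inE => /eqP sm.
  have := kP s sm; rewrite meanZ (vE k s (maxU _ sm) (mean (Delta (d s)) (v k))).
    lra.
  by rewrite -dk ffunE.
move=> /good_value => /(_ s1); rewrite finset.inE eqxx => /(_ isT).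
by rewrite leNgt (le_lt_trans (maxU s1 erefl)).
Unshelve. all: by end_near.
Qed.

End Discounting.

(** * Optimal stopping *)

Section Stopping.
Variables (R : realType) (M : mdp R) (F : state M -> R).
Local Notation S := (state M).
Local Notation A := (action M).
Implicit Types (s t : S) (a : A).

Definition stopping_value (b : R) (v : S -> R) :=
  [/\ 0 <= b < 1, forall s, 0 <= v s &
      forall s, v s = Num.max (F s) (b * mean (Delta (greedy v s)) v)].

Lemma stopping_ex (B b : R) : (forall s, 0 <= F s <= B) -> 0 <= b < 1 ->
  exists v, stopping_value b v /\ forall s, v s <= B.
Proof.
move=> FB b01; have /andP[b0 b1] := b01.
have B0 : 0 <= B by have /andP[] := FB (s0 M); exact: le_trans.
have [|s|s|v1 v2 v12 s|v [vB vE]] := @tarski R S 0 B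
    (fun v s => Num.max (F s) (b * mean (Delta (greedy v s)) v)).
- by [].
- by rewrite mean_cst mulr0 le_max lexx orbT.
- by rewrite mean_cst ge_max (andP (FB s)).2/= ler_piMl// ltW.
- rewrite ge_max le_max lexx/= le_max; apply/orP; right.
  by apply: ler_wpM2l => //; exact: greedy_mono.
- exists v; split=> [|s]; last by have /andP[] := vB s.
  by split=> // s; have /andP[] := vB s.
Qed.

(* Undiscounted stopping values are reached only in the limit: with [b < 1] the
   greedy action strictly increases the expected value of [v] wherever [v]
   differs from [F], so that following it cannot postpone stopping forever. *)
Lemma excessive_majorant (y : R) : (forall s, 0 <= F s) ->
  (forall b v, stopping_value b v -> v (s0 M) <= y) ->
  exists V : S -> R, [/\ forall s, F s <= V s,
    forall s a, a \in Av s -> mean (Delta a) V <= V s & V (s0 M) <= y].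
Proof.
move=> F0 hy; have [B [_ FB]] := fin_bound F.
have FB' s : 0 <= F s <= B by rewrite F0 (le_trans _ (FB s))// ler_norm.
pose q k : R := k.+1%:R; pose b k : R := 1 - (q k)^-1.
have b01 k : 0 <= b k < 1.
  by rewrite subr_ge0 gtrBl invr_gt0 ltr0n invf_le1 ?ler1n ?ltr0n.
have [v vP] := choice (fun k => stopping_ex FB' (b01 k)).
have [G [GU ooG]] := ultraFilterLemma (eventually_filter).
have /choice[V vV] : (forall s, exists l : R, v k s @[k --> G] --> l).
  move=> s; apply: (@ultra_cvg G GU R _ B) => k.
  by have [[_ v0 _] vB] := vP k; rewrite ger0_norm.
have b1 : b k @[k --> G] --> (1 : R).
  rewrite -[X in _ --> X]subr0; apply: cvgB; first exact: cvg_cst.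
  by move=> N /cvg_harmonic; exact: ooG.
exists V; split=> [s|s a aA|].
- apply: (cvgr_to_ge (vV s)); apply: nearW => k.
  by have [[_ _ ->] _] := vP k; rewrite le_max lexx.
- have bV : b k * mean (Delta a) (v k) @[k --> G] --> mean (Delta a) V.
    by rewrite -[X in _ --> X]mul1r; apply: cvgM => //; exact: mean_cvg.
  apply: (ler_cvg_to bV (vV s)).
  apply: nearW => k; have [[/andP[bk _] _ vE] _] := vP k.
  rewrite [leRHS]vE le_max; apply/orP; right.
  by apply: ler_wpM2l => //; exact: greedy_max.
- by apply: (cvgr_to_le (vV _)); apply: nearW => k; apply: hy; exact: (vP k).1.
Qed.

End Stopping.
(** * Controlled processes *)

Section Histories.
Context d (Om : measurableType d) (X : finType) (xi : nat -> Om -> X).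
Implicit Types (x : X) (l : seq X) (w : Om).

(* History, most recent pair first. *)
Fixpoint hist (n : nat) w : seq X :=
  if n is k.+1 then xi k w :: hist k w else [::].

Hypothesis mxi : forall n x, measurable [set w | xi n w = x].

Lemma measurable_proc n (Q : set X) : measurable [set w | Q (xi n w)].
Proof.
rewrite (_ : [set w | _] = \bigcup_(x in Q) [set w | xi n w = x]).
  by apply: fin_bigcup_measurable => // x _; exact: mxi.
by apply/seteqP; split=> [w Qw|w [x Qx /= ->]//]; exists (xi n w).
Qed.

Lemma measurable_history n (Q : set (seq X)) : measurable [set w | Q (hist n w)].
Proof.
elim: n Q => [|n IH] Q /=.
  have [q|q] := pselect (Q [::]).
    by rewrite (_ : [set _ | _] = setT)//; apply/seteqP; split.
  by rewrite (_ : [set _ | _] = set0)//; apply/seteqP; split.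
rewrite (_ : [set w | _] = \bigcup_(x in [set: X])
    ([set w | xi n w = x] `&` [set w | Q (x :: hist n w)])).
  apply: fin_bigcup_measurable => // x _; apply: measurableI; first exact: mxi.
  exact: (IH [set l | Q (x :: l)]).
by apply/seteqP; split=> [w Qw|w [x _ /= [-> ?]]//]; exists (xi n w).
Qed.

End Histories.

Section Controlled.
Context d (Om : measurableType d) (R : realType) (P : probability Om R).
Variables (M : mdp R) (xi : nat -> Om -> state M * action M).
Variable adm : pred (state M * action M).
Local Notation S := (state M).
Local Notation A := (action M).
Local Notation X := (S * A)%type.
Implicit Types (s t : S) (a : A) (x y : X) (l : seq X) (B : set Om) (w : Om).

(** What remains of a strategy once its memory is forgotten. Actions may depend on the past in any
    way; [ctrl_step] only asks that, given an event [H] of earlier pairs and the current pair, the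
    next state follows [Delta]. [adm] holds what is known of the actions: that they are available,
    or that they follow a fixed policy. *)
Record controlled : Prop := Controlled {
  ctrl_meas : forall n x, measurable [set w | xi n w = x];
  ctrl_init : P [set w | (xi 0 w).1 != s0 M] = 0%E;
  ctrl_step : forall n (H : set (seq X)) x t,
    P ([set w | H (hist xi n w)] `&` [set w | xi n w = x] `&`
       [set w | (xi n.+1 w).1 = t]) =
    (P ([set w | H (hist xi n w)] `&` [set w | xi n w = x]) * (Delta x.2 t)%:E)%E;
  ctrl_adm : forall n, P [set w | ~~ adm (xi n w)] = 0%E }.

Hypothesis ctrl : controlled.

Definition prob B : R := fine (P B).

Lemma probE B : measurable B -> P B = (prob B)%:E.
Proof. by move=> mB; rewrite fineK// fin_num_measure. Qed.

Lemma prob_ge0 B : 0 <= prob B.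
Proof. exact/fine_ge0/measure_ge0. Qed.

Lemma measurable_xi n (Q : set X) : measurable [set w | Q (xi n w)].
Proof. exact: measurable_proc (ctrl_meas ctrl) n Q. Qed.

Lemma measurable_hist n (Q : set (seq X)) : measurable [set w | Q (hist xi n w)].
Proof. exact: measurable_history (ctrl_meas ctrl) n Q. Qed.

Lemma prob_partition (Y : finType) (f : Om -> Y) B : measurable B ->
  (forall z, measurable [set w | f w = z]) ->
  prob B = \sum_z prob (B `&` [set w | f w = z]).
Proof.
move=> mB mf; have mBf (z : Y) : measurable (B `&` [set w | f w = z]) by exact: measurableI.
apply: EFin_inj; rewrite -sumEFin -probE//.
rewrite (eq_bigr (fun z => P (B `&` [set w | f w = z]))); last first.
  by move=> z _; rewrite probE.
have YT : [set` index_enum Y] = [set: Y].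
  by apply/seteqP; split=> z //= _; rewrite mem_index_enum.
rewrite fsbig_seq ?index_enum_uniq// -measure_fin_bigcup//.
- congr (P _); rewrite YT; apply/seteqP; split=> [w Bw|w [? _ []]//].
  by exists (f w).
- by apply/trivIsetP => y z _ _ /eqP yz; apply/seteqP; split=> // w [[_ /= fy] [_ /= fz]];
  apply: yz; rewrite -fy -fz.
Qed.

Lemma prob_nadm n x B : measurable B -> ~~ adm x -> prob (B `&` [set w | xi n w = x]) = 0.
Proof.
move=> mB ax; rewrite /prob (_ : P _ = 0%E)//; apply/eqP; rewrite -measure_le0.
rewrite -(ctrl_adm ctrl n); apply: le_measure; rewrite ?inE.
- by apply: measurableI => //; exact: ctrl_meas.
- exact: (measurable_xi n [set x | ~~ adm x]).
- by move=> w [_ /= ->].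
Qed.

(** A sum over the words of length [n], unfolded in the order of [hist], so that one more step of
    the process is one more inner sum. *)
Fixpoint wsum n (F : seq X -> R) : R :=
  if n is k.+1 then wsum k (fun l => \sum_x F (x :: l)) else F [::].

Lemma eq_wsum n F G : F =1 G -> wsum n F = wsum n G.
Proof.
by elim: n F G => [|n IH] F G FG /=; [exact: FG|apply: IH => l; apply: eq_bigr].
Qed.

Lemma le_wsum n F G : (forall l, F l <= G l) -> wsum n F <= wsum n G.
Proof.
by elim: n F G => [|n IH] F G FG /=; [exact: FG|apply: IH => l; apply: ler_sum].
Qed.

Lemma wsumZ n k F : wsum n (fun l => k * F l) = k * wsum n F.
Proof.
elim: n F => //= n IH F; rewrite -IH; apply: eq_wsum => l.
by rewrite mulr_sumr.
Qed.

Lemma prob_wsum n B : measurable B ->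
  prob B = wsum n (fun l => prob (B `&` [set w | hist xi n w = l])).
Proof.
move=> mB; elim: n => /= [|n ->]; first by congr prob; apply/seteqP; split=> // w [].
apply: eq_wsum => l.
rewrite (prob_partition (f := xi n)); last exact: ctrl_meas.
  apply: eq_bigr => x _; congr prob; apply/seteqP; split=> w /=.
    by move=> [[? <-] <-].
  by move=> [? [-> ->]].
by apply: measurableI => //; exact: (measurable_hist n [set l' | l' = l]).
Qed.

(** The expectation of [F (hist xi n w)], as a finite sum free of integrability conditions. *)
Definition ew n (F : seq X -> R) : R :=
  wsum n (fun l => prob [set w | hist xi n w = l] * F l).

Lemma ew_pred n (Q : pred (seq X)) :
  ew n (fun l => (Q l)%:R) = prob [set w | Q (hist xi n w)].
Proof.
rewrite (prob_wsum n); last exact: (measurable_hist n [set l | Q l]).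
apply: eq_wsum => l; have [Ql|Ql] := boolP (Q l).
  rewrite mulr1; congr prob; apply/seteqP; split=> w /=; last by case.
  by move=> hl; rewrite hl.
rewrite mulr0 (_ : _ `&` _ = set0) ?/prob ?measure0//.
by apply/seteqP; split=> // w [/= + hl]; rewrite hl (negbTE Ql).
Qed.

Lemma ewZ n k F : ew n (fun l => k * F l) = k * ew n F.
Proof. by rewrite -wsumZ; apply: eq_wsum => l; rewrite mulrCA. Qed.

Lemma hist_cons n x l :
  [set w | hist xi n.+1 w = x :: l] = [set w | hist xi n w = l] `&` [set w | xi n w = x].
Proof. by apply/seteqP; split=> w /= [-> ->]. Qed.

Lemma le_ew_adm n F G : (forall x l, adm x -> F (x :: l) <= G (x :: l)) ->
  ew n.+1 F <= ew n.+1 G.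
Proof.
move=> FG; rewrite /ew /=; apply: le_wsum => l; apply: ler_sum => x _.
have [ax|ax] := boolP (adm x); first by rewrite ler_wpM2l ?FG// prob_ge0.
rewrite hist_cons prob_nadm ?mul0r//.
exact: (measurable_hist n [set l' | l' = l]).
Qed.

Lemma ew_behead n F : ew n.+1 (fun l => F (behead l)) = ew n F.
Proof.
rewrite /ew /=; apply: eq_wsum => l /=; rewrite -mulr_suml; congr (_ * _).
rewrite [RHS](prob_partition (f := xi n)); last exact: ctrl_meas.
  by apply: eq_bigr => x _; rewrite -hist_cons.
exact: (measurable_hist n [set l' | l' = l]).
Qed.

(** Only the law of the next state is prescribed: grouping the next pairs by state sums out the
    unknown choice of action. *)
Lemma prob_step n (H : set (seq X)) x (v : S -> R) :
  let B := [set w | H (hist xi n w)] `&` [set w | xi n w = x] in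
  \sum_y prob (B `&` [set w | xi n.+1 w = y]) * v y.1 = prob B * mean (Delta x.2) v.
Proof.
move=> B; have mB : measurable B.
  by apply: measurableI; [exact: measurable_hist|exact: ctrl_meas].
have mX t : measurable [set w | (xi n.+1 w).1 = t].
  exact: (measurable_xi n.+1 [set x | x.1 = t]).
rewrite (partition_big (fun y => y.1) xpredT)//= /mean mulr_sumr.
apply: eq_bigr => t _; rewrite mulrA; have -> : prob B * Delta x.2 t =
    prob (B `&` [set w | (xi n.+1 w).1 = t]).
  apply: EFin_inj; rewrite EFinM -(probE mB) -probE; last exact: measurableI.
  by rewrite (ctrl_step ctrl).
rewrite (eq_bigr (fun y => prob (B `&` [set w | xi n.+1 w = y]) * v t)); last first.
  by move=> y /eqP ->.
rewrite -mulr_suml; congr (_ * _).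
rewrite [RHS](prob_partition (f := xi n.+1)); last exact: ctrl_meas.
  rewrite big_mkcond; apply: eq_bigr => y _; case: ifPn => [/eqP yt|yt].
    congr prob; apply/seteqP; split=> w /= [Bw wy]; last by case: Bw.
    by rewrite wy.
  rewrite (_ : _ `&` _ = set0) ?/prob ?measure0//.
  by apply/seteqP; split=> // w [[_ /= wt] /= wy]; rewrite -wt wy eqxx in yt.
exact: measurableI.
Qed.

(** The Markov property inside an expectation: [F] sees the history up to the current pair, [v] only
    the state that comes next. *)
Lemma ew_step n F (v : S -> R) :
  ew n.+2 (fun l => if l is y :: l' then F l' * v y.1 else 0) =
  ew n.+1 (fun l => if l is x :: _ then F l * mean (Delta x.2) v else 0).
Proof.
rewrite /ew [LHS]/=; apply: eq_wsum => l; apply: eq_bigr => x _.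
have := prob_step n [set l' | l' = l] x v; rewrite /= -hist_cons mulrCA => <-.
by rewrite mulr_sumr; apply: eq_bigr => y _; rewrite mulrCA -hist_cons.
Qed.

Definition marg n x : R := prob [set w | xi n w = x].

Lemma marg_step n (v : S -> R) :
  \sum_y marg n.+1 y * v y.1 = \sum_x marg n x * mean (Delta x.2) v.
Proof.
rewrite [RHS](eq_bigr (fun x => \sum_y prob ([set w | xi n w = x] `&`
    [set w | xi n.+1 w = y]) * v y.1)); last first.
  move=> x _; have := prob_step n setT x v.
  by have -> : [set w | [set: seq X] (hist xi n w)] = setT by []; rewrite setTI => ->.
rewrite [RHS]exchange_big /=; apply: eq_bigr => y _; rewrite -mulr_suml; congr (_ * _).
rewrite /marg (prob_partition (f := xi n)); try exact: ctrl_meas.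
by apply: eq_bigr => x _; rewrite setIC.
Qed.

Lemma marg_init (v : S -> R) : \sum_x marg 0 x * v x.1 = v (s0 M).
Proof.
have m1 : \sum_x marg 0 x = 1.
  transitivity (prob setT); last by rewrite /prob probability_setT.
  rewrite (prob_partition (f := xi 0) measurableT); last exact: ctrl_meas.
  by apply: eq_bigr => x _; rewrite setTI.
rewrite -[RHS]mul1r -m1 mulr_suml; apply: eq_bigr => x _.
have [->//|xs] := eqVneq x.1 (s0 M).
suff -> : marg 0 x = 0 by rewrite !mul0r.
rewrite /marg /prob (_ : P _ = 0%E)//; apply/eqP; rewrite -measure_le0.
rewrite -(ctrl_init ctrl); apply: le_measure; rewrite ?inE.
- exact: ctrl_meas.
- exact: (measurable_xi 0 [set x | x.1 != s0 M]).
- by move=> w /= ->.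
Qed.

Lemma marg_nadm n x : ~~ adm x -> marg n x = 0.
Proof. by move=> ax; rewrite /marg -[[set _ | _]]setTI prob_nadm. Qed.

End Controlled.

(** * Almost sure behaviour of excessive functions *)

Section AlmostSure.
Context d (Om : measurableType d) (R : realType) (P : probability Om R).

Lemma borel_cantelli (E : nat -> set Om) (K : R) : (forall n, measurable (E n)) ->
  (forall N, \sum_(n < N) prob P (E n) <= K) ->
  {ae P, forall w, \forall n \near \oo, ~ E n w}.
Proof.
move=> mE sK; exists (lim_sup_set E); split.
- apply: bigcap_measurableType => n _; exact: bigcup_measurable.
- apply: lim_sup_set_cvg0 => //; apply: (@le_lt_trans _ _ K%:E); last exact: ltry.
  apply: lime_le; first by apply: is_cvg_nneseries => n _ _; exact: measure_ge0.
  apply: nearW => N; rewrite big_mkord.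
  rewrite (eq_bigr (fun n : 'I_N => (prob P (E n))%:E)); last by move=> n _; exact: probE (mE n).
  by rewrite sumEFin lee_fin; exact: sK.
- move=> w /= nE n _; apply: contrapT => nEn; apply: nE.
  exists n => // m /= nm Em; apply: nEn; exists m => //.
Qed.

Variables (M : mdp R) (xi : nat -> Om -> state M * action M).
Variable adm : pred (state M * action M).
Local Notation S := (state M).
Local Notation A := (action M).
Local Notation X := (S * A)%type.
Hypothesis ctrl : controlled P xi adm.
Implicit Types (s t : S) (a : A) (x y : X) (w : Om).

Definition excessive (V : S -> R) :=
  forall y, adm y -> mean (Delta y.2) V <= V y.1.

Lemma ae_adm : {ae P, forall w, forall n, adm (xi n w)}.
Proof.
apply: ae_foralln => n; exists [set w | ~~ adm (xi n w)]; split.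
- exact: (measurable_xi ctrl n [set x | ~~ adm x]).
- exact: ctrl_adm ctrl n.
- by move=> w /= /negP.
Qed.

Lemma ae_support : {ae P, forall w, forall n, Delta (xi n w).2 (xi n.+1 w).1 != 0}.
Proof.
apply: ae_foralln => n.
have aexy x t : Delta x.2 t = 0 ->
    {ae P, forall w, ~ (xi n w = x /\ (xi n.+1 w).1 = t)}.
  move=> xt; exists ([set w | xi n w = x] `&` [set w | (xi n.+1 w).1 = t]); split.
  - apply: measurableI; first exact: (ctrl_meas ctrl).
    exact: (measurable_xi ctrl n.+1 [set y | y.1 = t]).
  - have := ctrl_step ctrl n setT x t; rewrite xt mule0.
    by have -> : [set w | [set: seq X] (hist xi n w)] = setT by []; rewrite setTI.
  - by move=> w /= /contrapT.
have : {ae P, forall w, forall x, forall t, Delta x.2 t = 0 -> ~ (xi n w = x /\ (xi n.+1 w).1 = t)}.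
  apply: filter_forall => x; apply: filter_forall => t.
  have [xt|xt] := pselect (Delta x.2 t = 0); last by apply: filterE => w.
  by apply: filterS (aexy x t xt) => w.
apply: filterS => w H; apply/eqP => /H; exact.
Qed.

Lemma marg_ge0 n x : 0 <= marg P xi n x.
Proof. exact: prob_ge0. Qed.

Lemma marg_excessive n (V : S -> R) : excessive V ->
  \sum_x marg P xi n x * V x.1 <= V (s0 M).
Proof.
move=> exV; elim: n => [|n IH]; first by rewrite (marg_init ctrl).
rewrite (marg_step ctrl); apply: le_trans IH; apply: ler_sum => x _.
have [ax|ax] := boolP (adm x); first by rewrite ler_wpM2l ?marg_ge0// exV.
by rewrite (marg_nadm ctrl)// !mul0r.
Qed.

(* Each visit to [x] lowers the expected value of [V] by the same amount. *)
Lemma transient (V : S -> R) x : (forall s, 0 <= V s) -> excessive V ->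
  mean (Delta x.2) V < V x.1 -> {ae P, forall w, \forall n \near \oo, xi n w <> x}.
Proof.
move=> V0 exV; rewrite -subr_gt0; set dlt := V x.1 - _ => dlt0.
have [ax|ax] := boolP (adm x); last first.
  apply: filterS ae_adm => w adw; apply: nearW => n nx.
  by have := adw n; rewrite nx (negbTE ax).
apply: (@borel_cantelli _ (V (s0 M) / dlt)) => [n|N]; first exact: ctrl_meas ctrl n x.
rewrite ler_pdivlMr//.
(* Each visit is charged [dlt] against the budget [V (s0 M)], and what remains of the budget is
   nonnegative. *)
suff : (\sum_(n < N) marg P xi n x) * dlt + \sum_y marg P xi N y * V y.1 <= V (s0 M).
  apply: le_trans; rewrite lerDl; apply: sumr_ge0 => y _.
  by rewrite mulr_ge0 ?marg_ge0.
elim: N => [|N IH]; first by rewrite big_ord0 mul0r add0r (marg_init ctrl).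
apply: le_trans IH; rewrite big_ord_recr /= mulrDl -addrA lerD2l (marg_step ctrl).
rewrite (bigD1 x)//= [leRHS](bigD1 x)//= addrA lerD//.
  by rewrite -mulrDr /dlt subrK.
apply: ler_sum => y _; have [ay|ay] := boolP (adm y).
  by rewrite ler_wpM2l ?marg_ge0// exV.
by rewrite (marg_nadm ctrl)// !mul0r.
Qed.

(* Applied to the strictly concave transform [2BV - V^2], which is again
   excessive, [transient] excludes infinitely many moves changing [V]. *)
Lemma excessive_near_cst (V : S -> R) : (forall s, 0 <= V s) -> excessive V ->
  {ae P, forall w, exists N, forall n, (N <= n)%N -> V (xi n w).1 = V (xi N w).1}.
Proof.
move=> V0 exV; have [B [B0 VB']] := fin_bound V.
have VB s : V s <= B by rewrite (le_trans _ (VB' s))// ler_norm.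
pose U s := 2 * B * V s - V s ^+ 2.
have U0 s : 0 <= U s.
  have := mulr_ge0 (V0 s) (V0 s); have := V0 s; have := VB s.
  rewrite /U expr2; nra.
(* The loss of [U] is a mean square displacement of [V] plus a nonnegative multiple of the loss of
   [V], so it is positive at every pair that can change [V]. *)
have UE y : U y.1 - mean (Delta y.2) U =
    mean (Delta y.2) (fun t => (V t - V y.1) ^+ 2) +
    2 * (B - V y.1) * (V y.1 - mean (Delta y.2) V).
  rewrite -[in LHS](mean_cst (Delta y.2) (U y.1)) -[in RHS](mean_cst (Delta y.2) (V y.1)).
  by rewrite -!meanB -meanZ -meanD; apply: eq_bigr => t _; rewrite /U mean_cst; congr (_ * _); ring.
have sq0 y : 0 <= mean (Delta y.2) (fun t => (V t - V y.1) ^+ 2).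
  by apply: mean_ge => t _; exact: sqr_ge0.
have res0 y : adm y -> 0 <= 2 * (B - V y.1) * (V y.1 - mean (Delta y.2) V).
  by move=> ay; rewrite mulr_ge0 ?mulr_ge0 ?subr_ge0 ?exV.
have exU : excessive U.
  by move=> y ay; rewrite -subr_ge0 UE addr_ge0 ?res0.
have bad y : {ae P, forall w, \forall n \near \oo, xi n w = y ->
    forall t, Delta y.2 t != 0 -> V t = V y.1}.
  have [ay|ay] := boolP (adm y); last first.
    apply: filterS ae_adm => w adw; apply: nearW => n nx.
    by have := adw n; rewrite nx (negbTE ay).
  have [yconst|nconst] := pselect (forall t, Delta y.2 t != 0 -> V t = V y.1).
    by apply: filterE => w; apply: nearW.
  suff : {ae P, forall w, \forall n \near \oo, xi n w <> y}.
    by apply: filterS => w; apply: filterS => n ny /ny.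
  apply: (transient U0 exU); rewrite -subr_gt0 UE ltr_wpDr ?res0// lt_def sq0 andbT.
  apply/eqP => m0; apply: nconst => t yt; apply/eqP.
  rewrite -subr_eq0 -sqrf_eq0 -oppr_eq0; apply/eqP.
  apply: (@mean_eq_ub _ _ (Delta y.2) (fun t => - (V t - V y.1) ^+ 2) 0) => //.
    by move=> z; rewrite oppr_le0 sqr_ge0.
  by rewrite meanN m0 oppr0.
have : {ae P, forall w, forall y, \forall n \near \oo, xi n w = y ->
    forall t, Delta y.2 t != 0 -> V t = V y.1} by exact: filter_forall.
apply: filterS2 ae_support => w sup /filter_forall[N _ HN]; exists N => n.
elim: n => [|n IH]; first by rewrite leqn0 => /eqP ->.
rewrite leq_eqVlt => /predU1P[<-//|]; rewrite ltnS => Nn.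
by rewrite -(IH Nn); apply: (HN n Nn _ erefl) (sup n).
Qed.

Lemma measurable_fun_xi n (V : X -> R) :
  measurable_fun setT (fun w => V (xi n w)).
Proof.
by move=> _ B mB; rewrite setTI; exact: (measurable_xi ctrl n [set x | B (V x)]).
Qed.

Lemma integral_xi n (V : X -> R) : (forall x, 0 <= V x) ->
  (\int[P]_w (V (xi n w))%:E = (\sum_x marg P xi n x * V x)%:E)%E.
Proof.
move=> V0; rewrite (eq_integral (fun w =>
    \sum_x ((V x)%:E * (\1_[set w | xi n w = x] w)%:E)%E)%E); last first.
  move=> w _; rewrite (bigD1 (xi n w))//= indicE mem_set// mule1 big1 ?adde0// => x xn.
  rewrite indicE memNset ?mule0//= => /esym /eqP; exact/negP.
rewrite ge0_integral_sum//; last 2 first.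
- move=> x; apply/measurable_EFinP; apply: measurable_funM => //.
  by apply: measurable_indic; exact: ctrl_meas ctrl n x.
- by move=> x w _; rewrite mule_ge0// lee_fin.
rewrite -sumEFin; apply: eq_bigr => x _.
have mx := ctrl_meas ctrl n x.
rewrite ge0_integralZl_EFin//; last exact/measurable_EFinP/measurable_indic.
rewrite integral_indic// setIT EFinM muleC; congr (_ * _)%E.
by rewrite /marg /prob fineK// fin_num_measure.
Qed.

(** A substitute for optional stopping: [Y] is almost surely at most the lower limit of [V] along
    the run, and Fatou's lemma compares the integral of this limit with the expectations of [V], all
    at most [V (s0 M)]. *)
Lemma fatou_excessive (V : S -> R) (Y : Om -> R) : measurable_fun setT Y ->
  (forall w, 0 <= Y w) -> (forall s, 0 <= V s) -> excessive V ->
  {ae P, forall w, \forall n \near \oo, Y w <= V (xi n w).1} ->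
  (\int[P]_w (Y w)%:E <= (V (s0 M))%:E)%E.
Proof.
move=> mY Y0 V0 exV YV.
pose f n w := (V (xi n w).1)%:E.
have mf n : measurable_fun setT (f n).
  exact/measurable_EFinP/(measurable_fun_xi n (fun x => V x.1)).
have f0 n w : [set: Om] w -> (0 <= f n w)%E by rewrite lee_fin.
apply: (@le_trans _ _ (\int[P]_w limn_einf (f^~ w))%E).
  apply: ae_ge0_le_integral => //.
  - by move=> w _; rewrite lee_fin.
  - exact/measurable_EFinP.
  - move=> w _; rewrite limn_einf_lim; apply: lime_ge; first exact: is_cvg_einfs.
    apply: nearW => n; apply: le_ereal_inf_tmp => _ [m /= _ <-]; exact: f0.
  - apply: measurableT_comp => //; apply: measurable_fun_limn_esup => n.
    exact: measurableT_comp.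
  apply: filterS YV => w [N _ HN] _; rewrite limn_einf_lim.
  apply: lime_ge; first exact: is_cvg_einfs.
  exists N => // n /= Nn; apply: le_ereal_inf_tmp => _ [m /= nm <-].
  by rewrite lee_fin HN//= (leq_trans Nn).
apply: (le_trans (fatou P measurableT mf f0)); rewrite limn_einf_lim.
apply: lime_le; first exact: is_cvg_einfs.
apply: nearW => n; apply: (@le_trans _ _ (\int[P]_w f n w)%E).
  by apply: ereal_inf_lbound; exists n => /=.
have -> := integral_xi n (fun x : X => V0 x.1); by rewrite lee_fin marg_excessive.
Qed.

End AlmostSure.

(** * Exponential tails of averages *)

Lemma avg_le_tail (R : realType) (g g' : nat -> R) (c : R) N :
  (forall i, (N <= i)%N -> g i = g' i) ->
  (forall eps, 0 < eps -> \forall n \near \oo, \sum_(i < n) g' i <= n%:R * (c + eps)) ->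
  forall eps, 0 < eps -> \forall n \near \oo, \sum_(i < n) g i <= n%:R * (c + eps).
Proof.
move=> gg' avg eps eps0; have e20 : 0 < eps / 2 by rewrite divr_gt0.
(* The differing terms add at most the constant [D], which [n * (eps / 2)] absorbs for large [n]. *)
pose D := \sum_(i < N) `|g i - g' i|.
have sumD n : \sum_(i < n) g i <= \sum_(i < n) g' i + D.
  rewrite -lerBlDl -sumrB; apply: (@le_trans _ _ (\sum_(i < n | (i < N)%N) `|g i - g' i|)).
    rewrite [leRHS]big_mkcond; apply: ler_sum => i _; case: ifPn => [_|].
      exact: ler_norm.
    by rewrite -leqNgt => Ni; rewrite gg'// subrr.
  rewrite /D -(big_mkord (fun i => (i < N)%N) (fun i => `|g i - g' i|)).
  rewrite -(big_mkord xpredT (fun i => `|g i - g' i|)).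
  have [nN|Nn] := leqP n N.
    rewrite (big_cat_nat (n := n) (leq0n n) nN) /= ler_wpDr ?sumr_ge0//.
    by rewrite big_mkcond /=; apply: ler_sum => i _; case: ifP.
  rewrite (big_cat_nat (n := N) (leq0n N) (ltnW Nn)) /= [X in _ + X]big_nat_cond.
  rewrite [X in _ + X]big1 ?addr0; last by move=> i /andP[/andP[Ni _]]; rewrite ltnNge Ni.
  by rewrite big_mkcond /=; apply: ler_sum => i _; case: ifP.
have nD : \forall n \near \oo, D / (eps / 2) <= n%:R by exact: nbhs_infty_ger.
apply: filterS2 (avg _ e20) nD => n g'n.
rewrite ler_pdivrMr ?divr_gt0// => nD; apply: (le_trans (sumD n)).
apply: (@le_trans _ _ (n%:R * (c + eps / 2) + n%:R * (eps / 2))); first exact: lerD.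
by rewrite -mulrDr ler_wpM2l//; lra.
Qed.

Section LargeDeviation.
Context d (Om : measurableType d) (R : realType) (P : probability Om R).
Variables (M : mdp R) (xi : nat -> Om -> state M * action M).
Variable adm : pred (state M * action M).
Local Notation S := (state M).
Local Notation A := (action M).
Local Notation X := (S * A)%type.
Hypothesis ctrl : controlled P xi adm.
Implicit Types (s t : S) (a : A) (x y : X) (w : Om) (l : seq X).

(** From [1 - x <= expR (- x)] one gets [expR x <= 1 / (1 - x)], and [(1 - x) * (1 + x + 2 x^2) = 1
    + x^2 * (1 - 2 x)]. *)
Lemma expR_le_quad (x : R) : x <= 2^-1 -> expR x <= 1 + x + 2 * x ^+ 2.
Proof.
move=> x2; have x1 : 0 < 1 - x by lra.
rewrite -[expR x]invrK -expRN; apply: (@le_trans _ _ (1 - x)^-1).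
  by rewrite lef_pV2 ?posrE ?expR_gt0// expR_ge1Dx.
rewrite -[leLHS]mul1r ler_pdivrMr//.
have := mulr_ge0 (sqr_ge0 x) (_ : 0 <= 1 - 2 * x); rewrite !expr2 => H.
by have := H ltac:(lra); nra.
Qed.

Lemma hist_size n w : size (hist xi n w) = n.
Proof. by elim: n => //= n ->. Qed.

Lemma big_hist n w (g : X -> R) :
  \sum_(y <- hist xi n w) g y = \sum_(i < n) g (xi i w).
Proof.
by elim: n => [|n IH] /=; rewrite ?big_nil ?big_ord0// big_cons big_ord_recr/= IH addrC.
Qed.

(** An exponential supermartingale: averaging over the last state turns [u] into its mean, which the
    newest factor [k] brings back below [u]. *)
Lemma multiplicative_bound (k : X -> R) (u : S -> R) n : (forall y, 0 <= k y) ->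
  (forall y, adm y -> k y * mean (Delta y.2) u <= u y.1) ->
  ew P xi n.+1 (fun l => if l is x :: l' then \prod_(y <- l') k y * u x.1 else 0)
    <= u (s0 M).
Proof.
move=> k0 ku; elim: n => [|n IH].
  rewrite -(marg_init ctrl u) /ew /=; apply: ler_sum => x _.
  rewrite big_nil mul1r /marg le_eqVlt; apply/orP; left; apply/eqP; congr (prob P _ * _).
  by apply/seteqP; split=> w /= => [[]|->].
rewrite (ew_step ctrl n (fun l => \prod_(y <- l) k y)); apply: le_trans IH.
apply: (le_ew_adm ctrl) => x l ax; rewrite big_cons [k x * _]mulrC -mulrA.
by rewrite ler_wpM2l ?prodr_ge0// ku.
Qed.

Lemma drift_tail (g : X -> R) (h : S -> R) (c eps : R) : 0 < eps ->
  (forall y, adm y -> g y + mean (Delta y.2) h - h y.1 <= c) ->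
  exists th K : R, [/\ 0 < th, 0 < K & forall n, prob P
    [set w | n%:R * (c + 2 * eps) < \sum_(i < n) g (xi i w)] <= K * expR (- (th * eps)) ^+ n].
Proof.
move=> eps0 gh.
(* [z y t] is the compensated increment of a move to [t]; by [gh] its mean is at most [- eps]. *)
pose z (y : X) t := g y - c - eps + (h t - h y.1).
have [K [K0 zK']] := fin_bound (fun p : X * S => z p.1 p.2).
have zK y t : `|z y t| <= K := zK' (y, t).
(* Small enough for [th * K <= 1/2], as [expR_le_quad] requires, and for a quadratic term of at most
   [th * eps], which the negative mean of [th * z] pays for. *)
pose th := eps / (2 * K * (K + eps)).
have Ke0 : 0 < K + eps by exact: addr_gt0.
have th0 : 0 < th by rewrite divr_gt0// !mulr_gt0.
have thE : th * (2 * K * (K + eps)) = eps by rewrite /th divfK// gt_eqF// !mulr_gt0.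
have thK : th * K <= 2^-1 by nra.
have thK2 : 2 * th * K ^+ 2 <= eps by rewrite expr2; nra.
pose k y := expR (th * (g y - c - eps)).
pose u s := expR (th * h s).
have ku y : adm y -> k y * mean (Delta y.2) u <= u y.1.
  move=> ay; rewrite (_ : k y * _ =
      u y.1 * mean (Delta y.2) (fun t => expR (th * z y t))); last first.
    rewrite -!meanZ; apply: eq_bigr => t _; congr (_ * _).
    by rewrite -!expRD /z; congr expR; ring.
  rewrite ler_piMr ?expR_ge0//.
  apply: (@le_trans _ _ (mean (Delta y.2) (fun t => 1 + th * z y t + th * eps))).
    apply: le_mean => t; apply: (le_trans (expR_le_quad _)).
      by rewrite (le_trans _ thK)// ler_pM2l// (le_trans _ (zK y t))// ler_norm.
    rewrite lerD2l (_ : 2 * _ = th * (2 * th * z y t ^+ 2)); last by ring.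
    rewrite ler_pM2l// (le_trans _ thK2)// ler_pM2l; last by lra.
    by rewrite -real_normK ?num_real// lerXn2r ?nnegrE// ltW.
  rewrite (_ : mean _ _ = mean (Delta y.2)
      (fun t => 1 + th * (g y - c - h y.1) + th * h t)); last first.
    by apply: eq_bigr => t _; congr (_ * _); rewrite /z; ring.
  rewrite mean_affine.
  have := gh y ay; rewrite -(ler_pM2l th0); lra.
have [m [m0 mu]] := fin_pos_lb (fun s => expR_gt0 (th * h s)).
(* The lower bound [m] removes the final factor [u]. The gap between [c + eps] in [k] and
   [c + 2 * eps] in the event yields a factor [expR (th * eps)] per step. *)
exists th, (u (s0 M) / m); split=> // [|n]; first by rewrite divr_gt0// expR_gt0.
rewrite mulrAC ler_pdivlMr//.
pose Q l := (size l == n) && ((size l)%:R * (c + 2 * eps) < \sum_(y <- l) g y).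
rewrite (_ : [set w | _] = [set w | Q (hist xi n w)]); last first.
  by apply/seteqP; split=> w /=; rewrite /Q hist_size big_hist eqxx.
rewrite -(ew_pred ctrl) expRN exprVn ler_pdivlMr ?exprn_gt0 ?expR_gt0//.
apply: le_trans (multiplicative_bound n (fun y => expR_ge0 _) ku).
(* The event involves [n] pairs, the product bound [n.+1]: [ew_behead] adds the pair whose state
   carries [u]. *)
rewrite -mulrA mulrC -ewZ -(ew_behead ctrl).
apply: (le_ew_adm ctrl) => x l _ /=; rewrite /Q; case: (boolP (_ && _)) => [|_]; last first.
  by rewrite mulr0 mulr_ge0 ?expR_ge0// prodr_ge0// => y _; exact: expR_ge0.
have mux : m <= u x.1 := mu _.
move=> /andP[/eqP <- lg]; rewrite mulr1 mulrC ler_pM ?exprn_ge0 ?expR_ge0 ?(ltW m0)//.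
rewrite -expRM_natl -expR_sum ler_expR -mulr_sumr.
have -> : \sum_(y <- l) (g y - c - eps) = \sum_(y <- l) g y - (size l)%:R * (c + eps).
  rewrite !sumrB !big_const_seq count_predT !iter_addr_0.
  by rewrite -(mulr_natl c) -(mulr_natl eps) mulrDr opprD addrA.
by rewrite mulrCA ler_pM2l//; move: lg; rewrite !mulrDr; lra.
Qed.

Lemma drift_avg (g : X -> R) (h : S -> R) (c eps : R) : 0 < eps ->
  (forall y, adm y -> g y + mean (Delta y.2) h - h y.1 <= c) ->
  {ae P, forall w, \forall n \near \oo, \sum_(i < n) g (xi i w) <= n%:R * (c + 2 * eps)}.
Proof.
move=> eps0 gh; have [th [K [th0 K0 tail]]] := drift_tail eps0 gh.
set q := expR _ in tail.
have q0 : 0 < q by exact: expR_gt0.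
have q1 : 0 < 1 - q by rewrite subr_gt0 /q expR_lt1 oppr_lt0 mulr_gt0.
have : {ae P, forall w, \forall n \near \oo,
    ~ [set w | n%:R * (c + 2 * eps) < \sum_(i < n) g (xi i w)] w}.
  apply: (@borel_cantelli _ _ _ _ _ (K / (1 - q))) => [n|N].
    have -> : [set w | n%:R * (c + 2 * eps) < \sum_(i < n) g (xi i w)] =
        [set w | n%:R * (c + 2 * eps) < \sum_(y <- hist xi n w) g y].
      by apply/seteqP; split=> w /=; rewrite big_hist.
    exact: (measurable_hist ctrl n [set l | n%:R * (c + 2 * eps) < \sum_(y <- l) g y]).
  apply: (@le_trans _ _ (\sum_(n < N) K * q ^+ n)).
    by apply: ler_sum => n _; exact: tail.
  rewrite -mulr_sumr ler_pM2l// -[leRHS]mul1r ler_pdivlMr//.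
  have -> : (\sum_(i < N) q ^+ i) * (1 - q) = 1 - q ^+ N.
    by rewrite -[1 - q]opprB mulrN mulrC -subrX1 opprB.
  by rewrite gerBl exprn_ge0// ltW.
by apply: filterS => w; apply: filterS => n /negP; rewrite -leNgt.
Qed.

(* Outside [U] the reward is replaced by one low enough for the drift
   inequality to hold everywhere; along runs that eventually stay in [U] this
   changes finitely many terms only. *)
Lemma drift_avg_on (U : pred X) (g : X -> R) (h : S -> R) (c : R) :
  (forall y, adm y -> U y -> g y + mean (Delta y.2) h - h y.1 <= c) ->
  {ae P, forall w, (\forall n \near \oo, U (xi n w)) -> forall eps, 0 < eps ->
     \forall n \near \oo, \sum_(i < n) g (xi i w) <= n%:R * (c + eps)}.
Proof.
move=> gU; have [K [K0 hK]] := fin_bound (fun y : X => mean (Delta y.2) h - h y.1).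
pose g' y := if U y then g y else c - K.
have g'h y : adm y -> g' y + mean (Delta y.2) h - h y.1 <= c.
  rewrite /g'; case: ifPn => [Uy ay|_ _]; first exact: gU.
  have := hK y; rewrite ler_norml => /andP[_]; lra.
have : {ae P, forall w k, \forall n \near \oo,
    \sum_(i < n) g' (xi i w) <= n%:R * (c + 2 * (k.+1%:R)^-1)}.
  by apply: ae_foralln => k; apply: drift_avg g'h; rewrite invr_gt0.
apply: filterS => w avg [N _ NU];
  apply: (@avg_le_tail _ (fun i => g (xi i w)) (fun i => g' (xi i w)) c N).
  by move=> i Ni; rewrite /g' NU.
move=> eps eps0; have e20 : 0 < eps / 2 by rewrite divr_gt0.
have [k _ /(_ k (leqnn k)) keps] := near_infty_natSinv_lt (PosNum e20).
have {}keps : k.+1%:R^-1 < eps / 2 := keps.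
apply: filterS (avg k) => n /le_trans; apply; rewrite ler_wpM2l//.
by move: keps; move: (k.+1%:R^-1) => z; lra.
Qed.

End LargeDeviation.
(** * Mean payoff of a controlled process *)

Section MeanPayoffLimits.
Variable R : realType.

Lemma limn_einf_ge (u : nat -> \bar R) (a : \bar R) :
  (\forall n \near \oo, (a <= u n)%E) -> (a <= limn_einf u)%E.
Proof.
move=> [N _ HN]; rewrite limn_einf_lim; apply: lime_ge; first exact: is_cvg_einfs.
exists N => // n /= Nn; apply: le_ereal_inf_tmp => _ [m /= nm <-].
by apply: HN => /=; exact: leq_trans nm.
Qed.

Lemma limn_einf_le (u : nat -> \bar R) (a : \bar R) :
  (\forall n \near \oo, (u n <= a)%E) -> (limn_einf u <= a)%E.
Proof.
move=> ua; rewrite limn_einf_lim; apply: lime_le; first exact: is_cvg_einfs.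
by apply: filterS ua => n; apply: le_trans; apply: ereal_inf_lbound; exists n => /=.
Qed.

Variables (M : mdp R) (r : state M -> rat) (rho : nat -> state M).
Let g i : R := ratr (r (rho i)).
Let u n : \bar R := (n%:R^-1 * \sum_(i < n) g i)%:E.

Lemma mean_payoff_itv (B : R) : (forall s, `|ratr (r s)| <= B) ->
  ((- B)%:E <= limn_einf u <= B%:E)%E.
Proof.
move=> rB; have B0 : 0 <= B := le_trans (normr_ge0 _) (rB (rho 0)).
have uB n : `|n%:R^-1 * \sum_(i < n) g i| <= B.
  case: n => [|n]; first by rewrite invr0 mul0r normr0.
  rewrite normrM gtr0_norm ?invr_gt0// ler_pdivrMl ?ltr0n//.
  apply: (le_trans (ler_norm_sum _ _ _)).
  apply: (le_trans (ler_sum _ (fun i _ => rB _))).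
  by rewrite sumr_const card_ord mulr_natl.
by apply/andP; split; [apply: limn_einf_ge|apply: limn_einf_le];
  apply: nearW => n; rewrite lee_fin; have := uB n; rewrite ler_norml => /andP[].
Qed.

Lemma mean_payoffE : limn_einf u = (mean_payoff r rho)%:E.
Proof.
have [B [_ rB]] := fin_bound (fun s => ratr (r s) : R).
have /andP[u1 u2] := mean_payoff_itv rB.
by rewrite /mean_payoff fineK// fin_numElt (lt_le_trans _ u1) ?ltNyr// (le_lt_trans u2) ?ltry.
Qed.

Lemma mean_payoff_norm_le (B : R) : (forall s, `|ratr (r s)| <= B) ->
  `|mean_payoff r rho| <= B.
Proof.
by move=> /mean_payoff_itv; rewrite mean_payoffE !lee_fin ler_norml.
Qed.

Lemma mean_payoff_le (c : R) : (forall eps, 0 < eps -> \forall n \near \oo,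
  \sum_(i < n) g i <= n%:R * (c + eps)) -> mean_payoff r rho <= c.
Proof.
move=> hc; apply/ler_addgt0Pr => eps /hc[N _ HN].
rewrite -lee_fin -mean_payoffE; apply: limn_einf_le.
exists N.+1 => // n /= Nn; have n0 : 0 < n%:R :> R by rewrite ltr0n (leq_ltn_trans _ Nn).
by rewrite lee_fin ler_pdivrMl// HN//= ltnW.
Qed.

(** Phrased with [- g], so that upper bounds on drifts also yield lower bounds on the mean
    payoff. *)
Lemma mean_payoff_ge (c : R) : (forall eps, 0 < eps -> \forall n \near \oo,
  \sum_(i < n) - g i <= n%:R * (- c + eps)) -> c <= mean_payoff r rho.
Proof.
move=> hc; apply/ler_addgt0Pl => eps /hc[N _ HN].
rewrite -lerBlDl -lee_fin -mean_payoffE; apply: limn_einf_ge.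
exists N.+1 => // n /= Nn; have n0 : 0 < n%:R :> R by rewrite ltr0n (leq_ltn_trans _ Nn).
have := HN n (ltnW Nn); rewrite sumrN lee_fin ler_pdivlMl// -lerN2 opprK.
by rewrite -mulrN opprD opprK.
Qed.

(** There are finitely many states, so those visited finitely often have all disappeared after some
    time; among the others, one with the largest [v] is taken. *)
Lemma visited_i_o (v : state M -> R) :
  exists s, (forall N, exists n, (N <= n)%N /\ rho n = s) /\
    \forall n \near \oo, v (rho n) <= v s.
Proof.
pose io s := `[< forall N, exists n, (N <= n)%N /\ rho n = s >].
have nio : \forall n \near \oo, io (rho n).
  have : \forall n \near \oo, forall s, rho n = s -> io s.
    apply: filter_forall => s; case: (boolP (io s)) => [ios|nios]; first exact: nearW.
    have /existsNP[N /forallNP nN] := asboolPn _ nios.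
    by exists N => // n Nn rn; case: (nN n).
  by apply: filterS => n; apply.
have [n0 io0] := filter_ex nio.
pose s' := [arg max_(s > rho n0 | io s) v s]%O.
have [ios smax] : io s' /\ forall s, io s -> v s <= v s'.
  by rewrite /s'; case: arg_maxP.
by exists s'; split; [exact/asboolP|apply: filterS nio => n; exact: smax].
Qed.

End MeanPayoffLimits.

Section Bounds.
Context d (Om : measurableType d) (R : realType) (P : probability Om R).
Variables (M : mdp R) (xi : nat -> Om -> state M * action M).
Variable adm : pred (state M * action M).
Local Notation S := (state M).
Local Notation A := (action M).
Local Notation X := (S * A)%type.
Hypothesis ctrl : controlled P xi adm.
Hypothesis adm_Av : forall y, adm y -> y.2 \in Av y.1.
Implicit Types (s t : S) (a : A) (x y : X) (w : Om).

Lemma drift_avg_lim (U : pred X) (g : X -> R) (c : R) :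
  (forall eps, 0 < eps -> exists h, forall y, adm y -> U y ->
     g y + mean (Delta y.2) h - h y.1 <= c + eps) ->
  {ae P, forall w, (\forall n \near \oo, U (xi n w)) -> forall eps, 0 < eps ->
     \forall n \near \oo, \sum_(i < n) g (xi i w) <= n%:R * (c + eps)}.
Proof.
move=> cert.
have : {ae P, forall w k, (\forall n \near \oo, U (xi n w)) -> forall eps, 0 < eps ->
     \forall n \near \oo, \sum_(i < n) g (xi i w) <= n%:R * ((c + k.+1%:R^-1) + eps)}.
  apply: ae_foralln => k; have k0 : 0 < k.+1%:R^-1 :> R by rewrite invr_gt0.
  have [h hh] := cert _ k0; exact: (drift_avg_on ctrl hh).
apply: filterS => w H Uw eps eps0; have e20 : 0 < eps / 2 by rewrite divr_gt0.
have [k _ /(_ k (leqnn k)) keps] := near_infty_natSinv_lt (PosNum e20).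
have {}keps : k.+1%:R^-1 < eps / 2 := keps.
apply: filterS (H k Uw _ e20) => n /le_trans; apply; rewrite ler_wpM2l//.
by move: keps; move: (k.+1%:R^-1) => z; lra.
Qed.

Variables (r : S -> rat) (f : R -> R) (B : R).
Let rR s : R := ratr (r s).
Hypothesis f_mono : {homo f : x y / x <= y}.
Hypothesis rB : forall s, `|rR s| <= B.
Hypothesis f0 : 0 <= f (- B).
Let F s := f (value rR s).
Let Y w := f (mean_payoff r (fun n => (xi n w).1)).
Hypothesis mY : measurable_fun setT Y.

Lemma Y_ge0 w : 0 <= Y w.
Proof.
apply: (le_trans f0); apply: f_mono.
by have := mean_payoff_norm_le (fun n => (xi n w).1) rB; rewrite ler_norml => /andP[].
Qed.

Lemma Y_le w : Y w <= f B.
Proof.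
apply: f_mono.
by have := mean_payoff_norm_le (fun n => (xi n w).1) rB; rewrite ler_norml => /andP[].
Qed.

(** Almost every run settles [V] at its value in a state [s] visited infinitely often. With [s] of
    the largest secured value among those, [upper_certificate] bounds the mean payoff by
    [value rR s], and [F s <= V s] concludes through [fatou_excessive]. *)
Lemma payoff_upper (V : S -> R) : (forall s, F s <= V s) ->
  (forall s a, a \in Av s -> mean (Delta a) V <= V s) ->
  (\int[P]_w (Y w)%:E <= (V (s0 M))%:E)%E.
Proof.
move=> FV exV.
have F0 s : 0 <= F s.
  apply: (le_trans f0); apply/f_mono/value_ge => t.
  by have := rB t; rewrite ler_norml => /andP[].
have V0 s : 0 <= V s by rewrite (le_trans (F0 s)).
have exV' : excessive adm V by move=> y /adm_Av; exact: exV.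
apply: (fatou_excessive ctrl mY Y_ge0 V0 exV').
have lim : {ae P, forall w s, (\forall n \near \oo, value rR (xi n w).1 <= value rR s) ->
    forall eps, 0 < eps ->
    \forall n \near \oo, \sum_(i < n) rR (xi i w).1 <= n%:R * (value rR s + eps)}.
  apply: filter_forall => s.
  apply: (@drift_avg_lim (fun y => value rR y.1 <= value rR s) (fun y => rR y.1)) => eps eps0.
  have [h hh] := upper_certificate rR (value rR s) eps0.
  by exists h => y /adm_Av; exact: hh.
apply: filterS2 lim (excessive_near_cst ctrl V0 exV') => w lim [N VN].
have [s [ios ns]] := visited_i_o (fun n => (xi n w).1) (value rR).
have [m [Nm ms]] := ios N.
exists N => // n /= Nn; rewrite (VN n Nn) -(VN m Nm) ms (le_trans _ (FV s))//.
by apply: f_mono; apply: mean_payoff_le => eps eps0; exact: lim.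
Qed.

(** Under the policy [v] is a submartingale: where it equals [F], the action [e] never lowers the
    secured value; elsewhere the discount makes the mean of [v] strictly larger. Pairs of strict
    growth are transient, so the run ends up following [e] in states with [v = F]; there the secured
    value is monotone, hence eventually constant, and the mean payoff reaches it. *)
Lemma payoff_lower (e : S -> A) (b : R) (v : S -> R) :
  (forall s t, Delta (e s) t != 0 -> value rR s <= value rR t) ->
  (forall lam eps, 0 < eps -> exists h, forall s, value rR s = lam ->
    lam - eps <= rR s + mean (Delta (e s)) h - h s) ->
  stopping_value F b v ->
  (forall y, adm y -> y.2 = if v y.1 == F y.1 then e y.1 else greedy v y.1) ->
  ((v (s0 M))%:E <= \int[P]_w (Y w)%:E)%E.
Proof.
move=> e_supp e_cert [/andP[b0 b1] v0 vE] admE.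
have F0 s : 0 <= F s.
  apply: (le_trans f0); apply/f_mono/value_ge => t.
  by have := rB t; rewrite ler_norml => /andP[].
have Fv s : F s <= v s by rewrite vE le_max lexx.
have grow y : adm y -> v y.1 != F y.1 -> v y.1 < mean (Delta y.2) v.
  move=> /admE -> vF; rewrite (negbTE vF).
  have : v y.1 = b * mean (Delta (greedy v y.1)) v.
    by have := vE y.1; case: leP => // _ /eqP; rewrite (negbTE vF).
  have vpos : 0 < v y.1 by rewrite (le_lt_trans (F0 y.1))// lt_def vF Fv.
  move=> vy; rewrite [ltLHS]vy gtr_pMl//.
  by move: vpos; rewrite vy; apply: contraTT; rewrite -!leNgt => /(mulr_ge0_le0 b0).
have keep y : adm y -> v y.1 <= mean (Delta y.2) v.
  move=> ay; have [vF|/(grow y ay)/ltW//] := eqVneq (v y.1) (F y.1).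
  rewrite vF; apply: mean_ge => t; rewrite (admE _ ay) vF eqxx => /e_supp yt.
  by rewrite (le_trans _ (Fv t))//; exact: f_mono.
have [K [K0 vK']] := fin_bound v.
(* Bounding both [v] and [Y], [C] turns the submartingale into the nonnegative excessive function
   [C - v] and lets Fatou's lemma apply to [C - Y]. *)
pose C := Num.max K (f B).
have vC s : v s <= C by rewrite le_max (le_trans (ler_norm _) (vK' s)).
have YC w : Y w <= C by rewrite le_max Y_le orbT.
have exC : excessive adm (fun s => C - v s).
  by move=> y ay; rewrite meanB mean_cst lerD2l lerN2 keep.
have Cv0 s : 0 <= C - v s by rewrite subr_ge0.
have CY0 w : 0 <= C - Y w by rewrite subr_ge0.
have mCY : measurable_fun setT (fun w => C - Y w) by exact: measurable_funB.
suff nearY : {ae P, forall w, \forall n \near \oo, C - Y w <= C - v (xi n w).1}.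
  have := fatou_excessive ctrl mCY CY0 Cv0 exC nearY.
  have : (\int[P]_w (C - Y w)%:E + \int[P]_w (Y w)%:E = C%:E)%E.
    rewrite -ge0_integralD//.
    - under eq_integral do rewrite -EFinD subrK.
      rewrite integral_cst// -[RHS]mule1; congr (_ * _)%E.
      exact: probability_setT P.
    - by move=> w _; rewrite lee_fin.
    - exact/measurable_EFinP.
    - by move=> w _; rewrite lee_fin; exact: Y_ge0.
    - exact/measurable_EFinP.
  have : (0 <= \int[P]_w (Y w)%:E)%E.
    by apply: integral_ge0 => w _; rewrite lee_fin; exact: Y_ge0.
  case: (\int[P]_w (Y w)%:E)%E => [y| |]//; last by move=> *; exact: leey.
  case: (\int[P]_w (C - Y w)%:E)%E => [z| |]//; rewrite !lee_fin => _ -[<-]; lra.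
have lim : {ae P, forall w s, (\forall n \near \oo,
    (value rR (xi n w).1 == value rR s) && ((xi n w).2 == e (xi n w).1)) ->
    forall eps, 0 < eps ->
    \forall n \near \oo, \sum_(i < n) - rR (xi i w).1 <= n%:R * (- value rR s + eps)}.
  apply: filter_forall => s.
  apply: (@drift_avg_lim (fun y => (value rR y.1 == value rR s) && (y.2 == e y.1))
    (fun y => - rR y.1)) => eps eps0.
  have [h hh] := e_cert (value rR s) eps eps0.
  exists (fun t => - h t) => y _ /andP[/eqP /hh + /eqP ->]; rewrite meanN; lra.
have leave : {ae P, forall w, \forall n \near \oo, v (xi n w).1 = F (xi n w).1}.
  have : {ae P, forall w y, \forall n \near \oo, adm y -> v y.1 != F y.1 -> xi n w <> y}.
    apply: filter_forall => y.
    case: (boolP (adm y)) => [ay|ay]; last by apply: filterE => w; apply: nearW.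
    have [vF|vF] := eqVneq (v y.1) (F y.1); first by apply: filterE => w; apply: nearW.
    suff : {ae P, forall w, \forall n \near \oo, xi n w <> y}.
      by apply: filterS => w; apply: filterS.
    apply: (transient ctrl Cv0 exC); rewrite meanB mean_cst ltrD2l ltrN2.
    exact: grow.
  apply: filterS2 (ae_adm ctrl) => w aw /filter_forall; apply: filterS => n H.
  apply/eqP; apply/negPn/negP => vF; exact: (H _ (aw n) vF).
have aeadm := ae_adm ctrl; have aesup := ae_support ctrl.
apply: filterS2 (filterI lim leave) (filterI aeadm aesup).
move=> w [limw [N1 _ HN1]] [aw sw].
have eN n : (N1 <= n)%N -> (xi n w).2 = e (xi n w).1.
  by move=> Nn; rewrite (admE _ (aw n)) HN1// eqxx.
have mono n : (N1 <= n)%N -> value rR (xi n w).1 <= value rR (xi n.+1 w).1.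
  by move=> Nn; apply: e_supp; rewrite -(eN n Nn).
have mono2 n m : (N1 <= n)%N -> (n <= m)%N -> value rR (xi n w).1 <= value rR (xi m w).1.
  move=> Nn; elim: m => [|m IH]; first by rewrite leqn0 => /eqP ->.
  rewrite leq_eqVlt => /predU1P[->//|]; rewrite ltnS => nm.
  by rewrite (le_trans (IH nm))// mono// (leq_trans Nn).
have [s [ios [N2 _ HN2]]] := visited_i_o (fun n => (xi n w).1) (value rR).
have [N3 [N3N s3]] := ios (maxn N1 N2); move: N3N; rewrite geq_max => /andP[N31 N32].
have const n : (N3 <= n)%N -> value rR (xi n w).1 = value rR s.
  move=> Nn; apply/eqP; rewrite eq_le HN2/= ?(leq_trans N32)//.
  by rewrite -s3 mono2.
exists N3 => // n /= Nn; rewrite lerD2l lerN2 HN1/= ?(leq_trans N31)//.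
rewrite /F const//; apply: f_mono; apply: mean_payoff_ge; apply: limw.
exists N3 => // k /= Nk; rewrite const// eqxx/= eN//; exact: leq_trans Nk.
Qed.

End Bounds.
(** * The process induced by a strategy *)

Section CountableSums.
Variable R : realType.

Lemma esumZl (X : choiceType) (k : R) (f : X -> R) : 0 <= k -> (forall x, 0 <= f x) ->
  (\esum_(x in [set: X]) (k * f x)%:E = k%:E * \esum_(x in [set: X]) (f x)%:E)%E.
Proof.
move=> k0 f0.
have le c (g : X -> R) : 0 <= c -> (forall x, 0 <= g x) ->
    (\esum_(x in [set: X]) (c * g x)%:E <= c%:E * \esum_(x in [set: X]) (g x)%:E)%E.
  move=> c0 g0; apply: ge_ereal_sup => _ [Y [finY YT] <-].
  have -> : (\sum_(x \in Y) (c * g x)%:E = c%:E * \sum_(x \in Y) (g x)%:E)%E.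
    by rewrite !fsbig_finite//= !sumEFin -EFinM mulr_sumr.
  apply: lee_wpmul2l => //; apply: esum_ge; exists Y => //.
apply/eqP; rewrite eq_le le//=; have [->|kn0] := eqVneq k 0.
  by rewrite mul0e esum_ge0// => x _; rewrite mul0r.
have {}k0 : 0 < k by rewrite lt_def kn0.
(* The converse inequality is the first one for the factor [k^-1]. *)
have := le k^-1 (fun x => k * f x); rewrite invr_ge0 (ltW k0) => /(_ isT).
rewrite (eq_esum (b := fun x => (f x)%:E)); last by move=> x _; rewrite mulKf// gt_eqF.
move=> H; rewrite -lee_pdivlMl//; apply: H => x; by rewrite mulr_ge0// ltW.
Qed.

Lemma esum_distr (X : choiceType) (p : distr R X) (k : R) : 0 <= k ->
  (\esum_(x in [set: X]) (k * p x)%:E = k%:E)%E.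
Proof. by move=> k0; rewrite esumZl ?dfun_sum1 ?mule1//; exact: dfun_ge0. Qed.

Lemma measure_esum d (Om : measurableType d) (P : probability Om R) (C : countType)
    (f : Om -> C) (B : set Om) : measurable B ->
  (forall c, measurable [set w | f w = c]) ->
  (P B = \esum_(c in [set: C]) P (B `&` [set w | f w = c]))%E.
Proof.
move=> mB mf.
pose a k : \bar R := P (B `&` [set w | pickle (f w) = k]).
have -> : (\esum_(c in [set: C]) P (B `&` [set w | f w = c]) =
    \esum_(k in pickle @` [set: C]) a k)%E.
  rewrite esum_image; last by move=> ? ? _ _; exact: (pcan_inj pickleK).
  apply: eq_esum => c _; rewrite /a; congr (P (_ `&` _)).
  by apply/seteqP; split=> w /= => [->|/(pcan_inj pickleK)].
have mk k : (pickle @` [set: C]) k -> measurable (B `&` [set w | pickle (f w) = k]).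
  move=> [c _ <-]; apply: measurableI => //.
  rewrite (_ : [set _ | _] = [set w | f w = c])//.
  by apply/seteqP; split=> w /= => [/(pcan_inj pickleK)|->].
have -> : pickle @` [set: C] = [set k | k \in pickle @` [set: C]] by rewrite set_mem_set.
rewrite -(nneseries_esum (P := fun k => k \in pickle @` [set: C])); last first.
  by move=> k _; exact: measure_ge0.
rewrite -measure_bigcup//.
- congr (P _); apply/seteqP; split=> [w Bw|w [k _ []]//].
  by exists (pickle (f w)) => //; exists (f w).
- by apply/trivIsetP => i j _ _ /eqP ij; apply/seteqP; split=> // w [[_ /= wi] [_ /= wj]];
    apply: ij; rewrite -wi -wj.
Qed.

End CountableSums.

Section StrategyProcess.
Variables (R : realType) (M : mdp R) (sigma : strategy M).
Variable P : probability (run_space sigma) R.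
Hypothesis PI : induced_measure P.
Local Notation run := (run_space sigma).

Definition play (n : nat) (rho : run) : state M * action M :=
  (config_state (rho n), (rho n).2).

Lemma measurable_cylinder (w : run) n : measurable (cylinder w n : set run).
Proof. by apply: sub_sigma_algebra; exists w, n. Qed.

Lemma mkseq_cylinder n (rho w : run) :
  mkseq rho n.+1 = mkseq w n.+1 <-> cylinder w n rho.
Proof.
split=> [e i ni|e].
  by rewrite -[LHS](nth_mkseq (config0 sigma) rho (n := n.+1))// e nth_mkseq.
apply: (@eq_from_nth _ (config0 sigma)); rewrite !size_mkseq// => i ni.
by rewrite !nth_mkseq// e.
Qed.

Lemma measurable_mkseq n l : measurable [set rho : run | mkseq rho n.+1 = l].
Proof.
have [[w wl]|nw] := pselect (exists w : run, mkseq w n.+1 = l).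
  rewrite (_ : [set _ | _] = cylinder w n); first exact: measurable_cylinder.
  by apply/seteqP; split=> rho /=; rewrite -wl => /mkseq_cylinder.
rewrite (_ : [set _ | _] = set0)//; apply/seteqP; split=> // rho rl.
by apply: nw; exists rho.
Qed.

(** [B] is covered by the cylinders of its elements, and there are countably many prefixes of a
    given length. *)
Lemma prefix_null n (B : set run) : measurable B ->
  (forall w, B w -> P (cylinder w n) = 0%E) -> P B = 0%E.
Proof.
move=> mB B0; rewrite (measure_esum P (f := fun rho : run => mkseq rho n.+1) mB); last first.
  by move=> l; exact: measurable_mkseq.
apply: esum1 => l _.
have [[w [Bw wl]]|nw] := pselect (exists w, B w /\ mkseq w n.+1 = l); last first.
  rewrite (_ : _ `&` _ = set0) ?measure0//; apply/seteqP; split=> // w [Bw wl].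
  by apply: nw; exists w.
apply/eqP; rewrite -measure_le0 -(B0 w Bw); apply: le_measure; rewrite ?inE.
- by apply: measurableI => //; exact: measurable_mkseq.
- exact: measurable_cylinder.
- by move=> rho [_ /= rl]; apply/mkseq_cylinder; rewrite rl wl.
Qed.

Definition cyl_prob (w : run) n : R :=
  init_prob (w 0) * \prod_(i < n) step_prob (w i) (w i.+1).

Lemma init_prob_ge0 (x : config sigma) : 0 <= init_prob x.
Proof. by case: x => [[s m] a]; rewrite /init_prob !mulr_ge0// ?ler0n// dfun_ge0. Qed.

Lemma step_prob_ge0 (x y : config sigma) : 0 <= step_prob x y.
Proof. by case: x y => [[s m] a] [[t m'] b]; rewrite /step_prob !mulr_ge0// dfun_ge0. Qed.

Lemma cyl_prob_ge0 w n : 0 <= cyl_prob w n.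
Proof. by rewrite mulr_ge0 ?init_prob_ge0// prodr_ge0// => i _; exact: step_prob_ge0. Qed.

Lemma cylinder_next (w : run) n t m b :
  P (cylinder w n `&` [set rho | rho n.+1 = (t, m, b)]) =
  (cyl_prob w n * step_prob (w n) (t, m, b))%:E.
Proof.
pose w' : run := fun i => if i == n.+1 then (t, m, b) else w i.
have -> : cylinder w n `&` [set rho | rho n.+1 = (t, m, b)] = cylinder w' n.+1.
  apply/seteqP; split=> [rho [/= cw rn] i|rho cw].
    by rewrite leq_eqVlt /w' => /predU1P[->|]; [rewrite eqxx|rewrite ltnS => ni;
       rewrite cw// ltn_eqF// ltnS].
  split=> [i ni|/=]; last by rewrite cw// /w' eqxx.
  by rewrite cw ?leqW// /w' ltn_eqF.
rewrite PI big_ord_recr /= /w' eqxx (ltn_eqF (ltnSn n)) mulrA; congr (_ * _)%:E.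
congr (_ * _); apply: eq_bigr => i _.
by rewrite !ltn_eqF// ltnS// ltnW.
Qed.

(** Summing over the next memory element and the next action removes [update] and [next], each of
    total mass 1; only [Delta] remains. *)
Lemma cylinder_state (w : run) n t :
  P (cylinder w n `&` [set rho | config_state (rho n.+1) = t]) =
  (P (cylinder w n) * (Delta (w n).2 t)%:E)%E.
Proof.
have mB := measurableI _ _ (measurable_cylinder w n)
  (measurable_coord n.+1 [set x | config_state x = t]).
rewrite (measure_esum P (f := fun rho : run => (rho n.+1).1.2) mB); last first.
  by move=> m; exact: (measurable_coord n.+1 [set x | x.1.2 = m]).
have -> : P (cylinder w n) = (cyl_prob w n)%:E by rewrite PI.
case wn : (w n) => [[s m0] a] /=.
set k := cyl_prob w n; rewrite -EFinM.
have kD0 : 0 <= k * Delta a t by rewrite mulr_ge0 ?dfun_ge0// cyl_prob_ge0.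
rewrite -(esum_distr (update sigma a t m0) kD0); apply: eq_esum => m _.
have mB2 := measurableI _ _ mB (measurable_coord n.+1 [set x | x.1.2 = m]).
rewrite (measure_esum P (f := fun rho : run => (rho n.+1).2) mB2); last first.
  by move=> b; exact: (measurable_coord n.+1 [set x | x.2 = b]).
have kU0 : 0 <= k * Delta a t * update sigma a t m0 m by rewrite mulr_ge0 ?dfun_ge0.
rewrite -(esum_distr (Defs.next sigma t m) kU0); apply: eq_esum => b _.
have := cylinder_next w n t m b; rewrite wn /= !mulrA => <-; congr (P _).
apply/seteqP; split=> rho /=.
  by move=> [[[cw rt] rm] rb]; split=> //; move: rt rm rb;
     rewrite /config_state; case: (rho n.+1) => [[? ?] ?] /= -> -> ->.
by move=> [cw rn]; rewrite /config_state rn.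
Qed.

Variable adm : pred (state M * action M).
Hypothesis next_adm : forall s m a, Defs.next sigma s m a != 0 -> adm (s, a).

Lemma next_null (w : run) n : ~~ adm (play n w) -> P (cylinder w n) = 0%E.
Proof.
rewrite /play; case wn : (w n) => [[s m] a] /= aA.
have na : Defs.next sigma s m a = 0.
  by apply/eqP/negPn/negP => /next_adm; apply/negP.
rewrite PI; case: n wn => [|n] wn.
  by rewrite big_ord0 wn /= na mulr0 mul0r.
by rewrite big_ord_recr /= wn; case: (w n) => [[? ?] ?]; rewrite /= na !mulr0.
Qed.

Lemma hist_cylinder (w rho : run) n : cylinder w n rho ->
  hist play n.+1 rho = hist play n.+1 w.
Proof.
elim: n => [|n IH] cw; first by rewrite /= /play cw.
have e := IH (fun i ni => cw i (leqW ni)).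
rewrite -[LHS]/(play n.+1 rho :: hist play n.+1 rho).
by rewrite -[RHS]/(play n.+1 w :: hist play n.+1 w) e /play cw.
Qed.

Lemma controlled_play : controlled P play adm.
Proof.
split=> [n [s a]|||n].
- exact: (measurable_coord n [set x | (config_state x, x.2) = (s, a)]).
- apply: (@prefix_null 0) => [|w /= ws].
    exact: (measurable_coord 0 [set x | config_state x != s0 M]).
  rewrite PI big_ord0 mulr1; case: (w 0) ws => [[s m] a] /= /negbTE ->.
  by rewrite !mul0r.
- move=> n H [s a] t.
  set B := _ `&` [set rho | play n rho = _].
  have mplay k (Q : set (state M * action M)) : measurable [set rho | Q (play k rho)].
    exact: (measurable_coord k [set x | Q (config_state x, x.2)]).
  have mB : measurable B.
    apply: measurableI; last exact: (mplay n [set y | y = (s, a)]).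
    by apply: measurable_history => k y; exact: (mplay k [set z | z = y]).
  have mt := measurable_coord n.+1 [set x : config sigma | config_state x = t].
  rewrite (measure_esum P (f := fun rho : run => mkseq rho n.+1)
    (measurableI _ _ mB mt)); last first.
    by move=> l; exact: measurable_mkseq.
  rewrite (measure_esum P (f := fun rho : run => mkseq rho n.+1) mB); last first.
    by move=> l; exact: measurable_mkseq.
  have mBl l : measurable (B `&` [set rho | mkseq rho n.+1 = l]).
    by apply: measurableI => //; exact: measurable_mkseq.
  rewrite [X in (X * _)%E](eq_esum (b := fun l =>
      (prob P (B `&` [set rho | mkseq rho n.+1 = l]))%:E)); last first.
    by move=> l _; rewrite /prob fineK// fin_num_measure.
  rewrite muleC -esumZl ?dfun_ge0//; last by move=> l; exact: prob_ge0.
  apply: eq_esum => l _; rewrite EFinM.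
  have -> : (prob P (B `&` [set rho | mkseq rho n.+1 = l]))%:E =
    P (B `&` [set rho | mkseq rho n.+1 = l]) by rewrite /prob fineK// fin_num_measure.
  have [[w [Bw wl]]|nw] := pselect (exists w, B w /\ mkseq w n.+1 = l); last first.
    rewrite (_ : B `&` _ `&` _ = set0); last first.
      by apply/seteqP; split=> // w [[Bw _] wl]; apply: nw; exists w.
    rewrite (_ : B `&` _ = set0) ?measure0 ?mule0//.
    by apply/seteqP; split=> // w [Bw wl]; apply: nw; exists w.
  (* [B] depends on the first [n.+1] configurations only, so it contains every cylinder of that
     length that it meets, and [cylinder_state] applies. *)
  have Bcyl rho : cylinder w n rho -> B rho.
    move=> cw; have [] : hist play n.+1 rho = hist play n.+1 w by exact: hist_cylinder.
    by case: Bw => /= Hw ws p1 p2 hw; split; rewrite /= ?hw// -ws /play p1 p2.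
  rewrite (_ : B `&` _ `&` _ = cylinder w n `&` [set rho | config_state (rho n.+1) = t]).
    rewrite cylinder_state muleC; case: Bw => _ /= [_ <-]; congr (_ * P _)%E.
    apply/seteqP; split=> [rho cw|rho [_ /= rl]].
      by split; [exact: Bcyl|rewrite /= -wl; apply/mkseq_cylinder].
    by apply/mkseq_cylinder; rewrite rl wl.
  apply/seteqP; split=> [rho [[_ rt] /= rl]|rho [cw rt]].
    by split=> //; apply/mkseq_cylinder; rewrite rl wl.
  split; first by split=> //; exact: Bcyl.
  by rewrite /= -wl; apply/mkseq_cylinder.
- apply: (@prefix_null n) => [|w]; last exact: next_null.
  exact: (measurable_coord n [set x | ~~ adm (config_state x, x.2)]).
Qed.

End StrategyProcess.
(** * Construction of the run measure of a policy *)

Section InverseTransform.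
Variables (R : realType) (Y : eqType) (p : Y -> R) (y0 : Y).
Hypothesis p0 : forall y, 0 <= p y.
Implicit Types (l : seq Y) (u : R) (y z : Y).

(** Consecutive intervals of lengths [p y] are laid out from 0, [offset] being their left ends; the
    default [y0] is met only when [u] is at least the total mass. *)
Fixpoint select l u : Y :=
  if l is y :: l' then if u < p y then y else select l' (u - p y) else y0.

Fixpoint offset l z : R :=
  if l is y :: l' then if y == z then 0 else p y + offset l' z else 0.

Lemma offset_ge0 l z : 0 <= offset l z.
Proof. by elim: l => //= y l IH; case: ifP => // _; rewrite addr_ge0. Qed.

Lemma offset_le l z : z \in l -> offset l z + p z <= \sum_(y <- l) p y.
Proof.
elim: l => //= y l IH; rewrite inE big_cons eq_sym.
have [->|yz] := eqVneq y z; first by rewrite add0r lerDl sumr_ge0.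
by move=> /= zl; rewrite -addrA lerD2l IH.
Qed.

Lemma select_mem l u : 0 <= u < \sum_(y <- l) p y -> select l u \in l.
Proof.
elim: l u => [|y l IH] u /=; first by rewrite big_nil => /andP[/le_lt_trans/[apply]]; rewrite ltxx.
rewrite big_cons inE => /andP[u0 ul]; case: ltP => [_|py]; first by rewrite eqxx.
by rewrite IH ?orbT// subr_ge0 py ltrBlDl.
Qed.

Lemma select_itv l u z : uniq l -> z \in l -> 0 <= u < \sum_(y <- l) p y ->
  (select l u == z) = (offset l z <= u < offset l z + p z).
Proof.
elim: l u => //= y l IH u /andP[yl ul]; rewrite inE big_cons => zl /andP[u0 us].
case: ltP => [uy|yu].
  have [<-|yz] := eqVneq y z; first by rewrite add0r u0 uy.
  apply/esym/negbTE/negP => /andP[+ _]; apply/negP.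
  by rewrite -ltNge (lt_le_trans uy)// lerDl offset_ge0.
have u1 : 0 <= u - p y < \sum_(y <- l) p y by rewrite subr_ge0 yu ltrBlDl.
have [yz|yz] := eqVneq y z.
  rewrite add0r -yz (ltNge u) yu andbF; apply/eqP => sy.
  by move: yl; rewrite -sy select_mem.
rewrite IH//; last by move: zl; rewrite eq_sym (negbTE yz).
by rewrite lerBrDl ltrBlDl addrA.
Qed.

End InverseTransform.

Section MarkovPath.
Variables (R : realType) (Y : finType) (p : Y -> distr R Y).
Implicit Types (u : R) (x y z : Y).

Let l := index_enum Y.

(* The [n]-th state of the chain driven by one uniform variable [u]: each step
   is sampled by inversion and [u] is rescaled to the selected interval. *)
Fixpoint markov_path x u n : Y :=
  if n is k.+1 then
    let z := select (p x) x l u in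
    markov_path z ((u - offset (p x) l z) / p x z) k
  else x.

(** The interval of a path is the preimage of the interval of its tail under the rescaling
    [u -> (u - o) / q]; its length is thus multiplied by [q]. *)
Lemma markov_path_itv n (w : nat -> Y) : exists a b, [/\ 0 <= a, a <= b, b <= 1,
  b - a = \prod_(i < n) p (w i) (w i.+1) & forall u, 0 <= u < 1 ->
  (forall i, (i <= n)%N -> markov_path (w 0) u i = w i) <-> a <= u < b].
Proof.
elim: n w => [|n IH] w.
  exists 0, 1; split; rewrite ?ler01 ?lexx ?subr0 ?big_ord0// => u u01.
  by split=> // _ [|].
have [a [b [a0 ab b1 abE abP]]] := IH (w \o S).
set q := p (w 0) (w 1%N).
have q0 : 0 <= q by exact: dfun_ge0.
set o := offset (p (w 0)) l (w 1%N).
have o0 : 0 <= o by apply: offset_ge0; exact: dfun_ge0.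
have oq1 : o + q <= 1.
  by rewrite -(sum_distr (p (w 0))); apply: offset_le; rewrite ?mem_index_enum//; exact: dfun_ge0.
exists (o + q * a), (o + q * b); split.
- by rewrite addr_ge0// mulr_ge0.
- by rewrite lerD2l ler_wpM2l.
- by rewrite (le_trans _ oq1)// lerD2l ler_piMr.
- by rewrite opprD addrACA subrr add0r -mulrBr abE big_ord_recl.
move=> u /[dup] u01; rewrite -(sum_distr (p (w 0))) => u1.
have sel : (select (p (w 0)) (w 0) l u == w 1%N) = (o <= u < o + q).
  by apply: select_itv; rewrite ?index_enum_uniq ?mem_index_enum//; exact: dfun_ge0.
have step i : o <= u < o + q ->
    markov_path (w 0) u i.+1 = markov_path (w 1%N) ((u - o) / q) i.
  by rewrite -sel => /eqP /= ->.
split=> [h|/andP[au ub]].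
  have uo : o <= u < o + q by rewrite -sel; apply/eqP; rewrite -[LHS]/(markov_path (w 0) u 1) h.
  have /andP[ou uq] := uo.
  have qpos : 0 < q by rewrite -(ltrD2l o) addr0 (le_lt_trans ou).
  have /abP[+ _] : 0 <= (u - o) / q < 1.
    by rewrite divr_ge0 ?subr_ge0//= ltr_pdivrMr// mul1r ltrBlDl.
  have /[swap]/[apply] : forall i, (i <= n)%N ->
      markov_path ((w \o S) 0) ((u - o) / q) i = (w \o S) i.
    by move=> i ni /=; rewrite -step// h.
  by rewrite ler_pdivlMr// ltr_pdivrMr// lerBrDl ltrBlDl ![_ * q]mulrC.
(* A nonempty interval excludes [q = 0], where the rescaling would divide by zero. *)
have qpos : 0 < q.
  rewrite lt_def q0 andbT; apply/eqP => qE.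
  by move: (le_lt_trans au ub); rewrite qE !mul0r ltxx.
have uo : o <= u < o + q.
  rewrite (le_trans _ au) ?lerDl ?mulr_ge0//=.
  by rewrite (lt_le_trans ub)// lerD2l ler_piMr.
have /andP[ou uq] := uo.
have /abP[_ +] : 0 <= (u - o) / q < 1.
  by rewrite divr_ge0 ?subr_ge0//= ltr_pdivrMr// mul1r ltrBlDl.
rewrite ler_pdivlMr// ltr_pdivrMr// lerBrDl ltrBlDl ![_ * q]mulrC au ub => /(_ isT) h.
by case=> // i ni; rewrite step// h.
Qed.

End MarkovPath.
Section Policy.
Variables (R : realType).

Lemma dirac_sum1 (X : choiceType) (x : X) :
  (\esum_(y in [set: X]) ((y == x)%:R : R)%:E = 1)%E.
Proof.
rewrite -[RHS](@esum_set1 R X x (fun=> 1%E))// [RHS]esum_mkcond.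
apply: eq_esum => y _; have [->|yx] := eqVneq y x; first by rewrite mem_set.
by rewrite memNset//=; exact/eqP.
Qed.

Definition dirac_distr (X : choiceType) (x : X) : distr R X :=
  Distr (fun y => ler0n R (y == x)) (dirac_sum1 x).

Variables (M : mdp R) (d : state M -> action M).
Hypothesis d_Av : forall s, d s \in Av s.

Lemma policy_next_Av (s : state M) (m : unit) a : dirac_distr (d s) a != 0 -> a \in Av s.
Proof. by rewrite /= pnatr_eq0 eqb0 negbK => /eqP ->. Qed.

Definition policy_strategy : strategy M :=
  @Strategy R M unit (fun _ _ _ => dirac_distr tt) (fun s _ => dirac_distr (d s))
    policy_next_Av (dirac_distr tt).

Lemma policy_strategy_dm : deterministic_memoryless policy_strategy.
Proof. by split; [exists tt => -[]|move=> s m; exists (d s)]. Qed.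

Definition uniform01 : probability (measurableTypeR R) R := uniform_prob (@ltr01 R).

Lemma uniform01_itv (a b : R) : 0 <= a -> a <= b -> b <= 1 ->
  uniform01 `[a, b[%classic = (b - a)%:E.
Proof.
move=> a0 ab b1; rewrite -[LHS]/(uniform_prob (@ltr01 R) `[a, b[%classic) /uniform_prob.
rewrite (eq_integral (cst 1%E)); last first.
  move=> u; rewrite inE/= in_itv/= => /andP[au ub]; rewrite /uniform_pdf.
  by rewrite (le_trans a0 au) (le_trans (ltW ub) b1) subr0 invr1.
rewrite integral_cst//= mul1e lebesgue_measure_itv /= lte_fin.
by case: ltP => [//|ba]; rewrite (le_anti (introT andP (conj ab ba))) subrr.
Qed.

Lemma uniform01_out : uniform01 (~` `[0, 1[%classic) = 0%E.
Proof.
rewrite probability_setC// uniform01_itv//.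
by rewrite subr0 subee.
Qed.

(** Inversion is meaningful on [[0, 1[] only; the other [u], a null set, are sent to 0 so that every
    [u] gives a path. *)
Let clip (u : R) : R := if 0 <= u < 1 then u else 0.

Definition policy_path (u : R) : run_space policy_strategy := fun n =>
  let s := markov_path (fun s => Delta (d s)) (s0 M) (clip u) n in (s, tt, d s).

Lemma policy_path_cylinder (w : run_space policy_strategy) n :
  measurable (policy_path @^-1` cylinder w n) /\
  uniform01 (policy_path @^-1` cylinder w n) =
    (init_prob (w 0) * \prod_(i < n) step_prob (w i) (w i.+1))%:E.
Proof.
pose st i := (w i).1.1.
have clip01 u : 0 <= clip u < 1.
  by rewrite /clip; case: ifP => // _; rewrite lexx ltr01.
have wE i : w i = (st i, tt, (w i).2) by rewrite /st; case: (w i) => [[? []] ?].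
have [st0|st0] := eqVneq (st 0) (s0 M); last first.
  have -> : policy_path @^-1` cylinder w n = set0.
    apply/seteqP; split=> // u /(_ 0 (leq0n n)) e; move: st0.
    by rewrite /st -e eqxx.
  split=> //; rewrite measure0 wE /= (negbTE st0) !mul0r //.
have [wd|/existsNP[i /not_implyP[ni wi]]] :=
    pselect (forall i, (i <= n)%N -> (w i).2 = d (st i)); last first.
  have -> : policy_path @^-1` cylinder w n = set0.
    apply/seteqP; split=> // u /(_ i ni) e; apply: wi.
    by rewrite /st -e.
  split=> //; rewrite measure0; congr EFin; apply/esym.
  case: i ni wi => [|i] ni; rewrite /st.
    by case: (w 0) => [[s []] a] /= /eqP/negbTE ->; rewrite mulr0 mul0r.
  rewrite (bigD1 (Ordinal ni))//=; case: (w i.+1) => [[s []] a] /= /eqP/negbTE sa.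
  by case: (w i) => [[t m] b] /=; rewrite sa mulr0 mul0r mulr0.
have [a [b [a0 ab b1 abE abP]]] := markov_path_itv (fun s => Delta (d s)) n st.
have cylE : policy_path @^-1` cylinder w n = [set u | a <= clip u < b].
  apply/seteqP; split=> u /=.
    move=> h; apply/abP => // i ni; rewrite st0.
    by have := h i ni; rewrite /policy_path (wE i) => -[].
  move/(abP _ (clip01 u)) => h i ni; rewrite /policy_path -st0 h//.
  by rewrite (wE i) wd.
(* Clipped points may enter the preimage when 0 lies in the interval; they contribute the null set
   [N]. *)
pose N := [set u | a <= clip u < b] `&` ~` `[0, 1[%classic.
have abN : [set u | a <= clip u < b] = `[a, b[%classic `|` N.
  apply/seteqP; split=> u /=.
    have [u01|u01] := boolP (u \in `[0, 1[%R); last by right; split=> //=; exact/negP.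
    by left; move: u01 H; rewrite /= in_itv /clip /= in_itv/= => ->.
  rewrite in_itv/= => -[/andP[au ub]|[]//].
  by rewrite /clip (le_trans a0 au) (lt_le_trans ub b1) au ub.
have mN : measurable N.
  rewrite (_ : N = if a <= 0 < b then ~` `[0, 1[%classic else set0).
    by case: ifP => // _; exact: measurableC.
  apply/seteqP; split=> u; rewrite /N /= in_itv /= /clip.
    by move=> [+ /negP/negbTE nu]; rewrite nu => -> /=; rewrite in_itv/= nu.
  case: ifP => // ab0 /=; rewrite in_itv/= => /negP/negbTE ->; split=> //; exact: ab0.
have N0 : uniform01 N = 0%E.
  apply/eqP; rewrite -measure_le0 -uniform01_out; apply: le_measure; rewrite ?inE//.
    exact: measurableC.
  by move=> u [].
rewrite cylE abN; split; first exact: measurableU.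
rewrite measureU0//; apply: (eq_trans (uniform01_itv a0 ab b1)); rewrite abE; congr EFin.
have -> : init_prob (w 0) = 1.
  move: st0 (wd 0 isT); rewrite /st; case: (w 0) => [[s []] a'] /= -> ->.
  by rewrite !eqxx !mul1r.
rewrite mul1r; apply: eq_bigr => i _.
move: (wd i (ltnW (ltn_ord i))) (wd i.+1 (ltn_ord i)); rewrite /st.
case: (w i) (w i.+1) => [[s []] a'] [[t []] b'] /= -> ->.
by rewrite !eqxx !mulr1.
Qed.

Lemma measurable_policy_path :
  measurable_fun [set: measurableTypeR R] policy_path.
Proof.
apply: (@measurability _ _ (measurableTypeR R) (run_space policy_strategy) setT
  policy_path (@cylinders R M policy_strategy)) => //.
move=> _ [_ [w [n ->]] <-]; rewrite setTI.
exact: (policy_path_cylinder w n).1.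
Qed.

Lemma policy_measure_ex : exists P : probability (run_space policy_strategy) R,
  induced_measure P.
Proof.
exists (distribution uniform01 (@mfun_Sub _ _ (measurableTypeR R)
  (run_space policy_strategy) _ (mem_set measurable_policy_path))).
by move=> w n; apply: eq_trans (policy_path_cylinder w n).2.
Qed.

End Policy.
(** * Value at risk and conditional value at risk *)

Section BoundedExpectation.
Context d (T : measurableType d) (R : realType) (P : probability T R).
Implicit Types (f g : T -> R).

Definition bounded_rv f := measurable_fun setT f /\ exists K : R, forall w, `|f w| <= K.

Lemma bounded_integrable (D : set T) f : measurable D -> bounded_rv f ->
  P.-integrable D (EFin \o f).
Proof.
move=> mD [mf [K fK]]; apply: measurable_bounded_integrable => //.
- by rewrite (le_lt_trans (probability_le1 P mD))// ltry.
- exact: measurable_funTS.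
- exists K; split; first exact: num_real.
  by move=> x Kx w _ /=; rewrite (le_trans (fK w))// ltW.
Qed.

Definition expect f : R := Rintegral P setT f.

Lemma expectE f : bounded_rv f -> (\int[P]_w (f w)%:E = (expect f)%:E)%E.
Proof.
move=> bf; rewrite /expect /Rintegral fineK//.
by apply: integrable_fin_num => //; exact: bounded_integrable.
Qed.

Lemma bounded_rv_cst k : bounded_rv (fun=> k).
Proof. by split; [exact: measurable_cst|exists `|k|]. Qed.

Lemma bounded_rvD f g : bounded_rv f -> bounded_rv g ->
  bounded_rv (fun w => f w + g w).
Proof.
move=> [mf [K fK]] [mg [L gL]]; split; first exact: measurable_funD.
by exists (K + L) => w; rewrite (le_trans (ler_normD _ _))// lerD.
Qed.

Lemma bounded_rvZ k f : bounded_rv f -> bounded_rv (fun w => k * f w).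
Proof.
move=> [mf [K fK]]; split; first exact: measurable_funM.
by exists (`|k| * K) => w; rewrite normrM ler_wpM2l.
Qed.

Lemma bounded_rv_indic (A : set T) : measurable A -> bounded_rv (\1_A : T -> R).
Proof.
move=> mA; split; first exact: measurable_indic.
by exists 1 => w; rewrite indicE ger0_norm// lern1 leq_b1.
Qed.

Lemma bounded_rv_mono (h : R -> R) f : {homo h : x y / x <= y} ->
  bounded_rv f -> bounded_rv (h \o f).
Proof.
move=> hm [mf [K fK]]; split.
  apply: measurableT_comp => //; exact: nondecreasing_measurable.
exists (`|h K| + `|h (- K)|) => w /=.
have := fK w; rewrite ler_norml => /andP[/hm h1 /hm h2].
have := ler_norm (h K); have := ler_norm (- h (- K)); rewrite normrN.
have := normr_ge0 (h K); have := normr_ge0 (h (- K)).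
by rewrite ler_norml => *; apply/andP; split; lra.
Qed.

Lemma le_expect f g : bounded_rv f -> bounded_rv g -> (forall w, f w <= g w) ->
  expect f <= expect g.
Proof. by move=> bf bg fg; apply: le_Rintegral => //; exact: bounded_integrable. Qed.

Lemma expectD f g : bounded_rv f -> bounded_rv g ->
  expect (fun w => f w + g w) = expect f + expect g.
Proof. by move=> bf bg; apply: RintegralD => //; exact: bounded_integrable. Qed.

Lemma expectZ k f : bounded_rv f -> expect (fun w => k * f w) = k * expect f.
Proof. by move=> bf; apply: RintegralZl => //; exact: bounded_integrable. Qed.

Lemma expect_cst k : expect (fun=> k) = k.
Proof.
apply: EFin_inj; rewrite -(expectE (bounded_rv_cst k)) integral_cst// -[RHS]mule1.
by congr (_ * _)%E; exact: probability_setT P.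
Qed.

Lemma expect_indic (A : set T) : measurable A -> expect (\1_A : T -> R) = prob P A.
Proof. by move=> mA; rewrite /expect /Rintegral integral_indic// setIT. Qed.

Variables (X : {RV P >-> R}) (p : R).
Hypothesis bX : bounded_rv X.
Hypothesis p01 : 0 < p < 1.

Lemma measurable_le r : measurable [set w | X w <= r].
Proof.
rewrite (_ : [set _ | _] = X @^-1` `]-oo, r]); first exact: measurable_funPTI.
by apply/seteqP; split=> w /=; rewrite in_itv.
Qed.

Lemma measurable_lt r : measurable [set w | X w < r].
Proof.
rewrite (_ : [set _ | _] = X @^-1` `]-oo, r[); first exact: measurable_funPTI.
by apply/seteqP; split=> w /=; rewrite in_itv.
Qed.

Lemma cdfE r : cdf X r = (prob P [set w | X w <= r])%:E.
Proof.
rewrite /cdf /distribution /pushforward /prob fineK.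
  by congr (P _); apply/seteqP; split=> w /=; rewrite in_itv.
by rewrite fin_num_measure//; exact: measurable_le.
Qed.

Lemma prob_mono (A B : set T) : measurable A -> measurable B -> A `<=` B ->
  prob P A <= prob P B.
Proof.
by move=> mA mB AB; apply: fine_le; rewrite ?fin_num_measure//; apply: le_measure; rewrite ?inE.
Qed.

Lemma VaR_has_sup : has_sup [set r : R | (cdf X r <= p%:E)%E].
Proof.
have /andP[p0 p1] := p01; have [_ [K XK]] := bX; split.
  exists (- K - 1); rewrite /= cdfE lee_fin (_ : [set _ | _] = set0).
    by rewrite /prob measure0 ltW.
  apply/seteqP; split=> // w /=; apply/negP; rewrite -ltNge.
  by have := XK w; rewrite ler_norml => /andP[]; lra.
exists K => r /=; rewrite cdfE lee_fin; apply: contraTT; rewrite -!ltNge => Kr.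
rewrite (_ : [set _ | _] = setT) ?/prob ?probability_setT//.
apply/seteqP; split=> // w _ /=.
by rewrite (le_trans (ler_norm _))// (le_trans (XK w))// ltW.
Qed.

Lemma lt_VaR r : r < VaR X p -> prob P [set w | X w <= r] <= p.
Proof.
rewrite -subr_gt0 => /sup_adherent /(_ VaR_has_sup)[r' /=].
rewrite -/(VaR X p) subKr cdfE lee_fin => r'p rr'; apply: le_trans r'p.
apply: prob_mono; try exact: measurable_le.
by move=> w /= /le_trans; apply; exact: ltW.
Qed.

Lemma gt_VaR r : VaR X p < r -> p < prob P [set w | X w <= r].
Proof.
rewrite ltNge; apply: contraR; rewrite -leNgt => rp.
by apply: (sup_ubound VaR_has_sup.2); rewrite /= cdfE lee_fin.
Qed.

Lemma prob_lt_le v : (forall r, r < v -> prob P [set w | X w <= r] <= p) ->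
  prob P [set w | X w < v] <= p.
Proof.
move=> hp; rewrite -lee_fin {1}/prob fineK; last first.
  by rewrite fin_num_measure//; exact: measurable_lt.
pose F n := [set w | X w <= v - n.+1%:R^-1].
have FE : [set w | X w < v] = \bigcup_n F n.
  apply/seteqP; split=> [w /= wv|w [n _ /= /le_lt_trans]]; last first.
    by apply; rewrite gtrBl invr_gt0.
  have wv0 : 0 < v - X w by rewrite subr_gt0.
  have [k _ /(_ k (leqnn k)) kw] := near_infty_natSinv_lt (PosNum wv0).
  have {}kw : k.+1%:R^-1 < v - X w := kw.
  by exists k => //; rewrite /F/=; move: kw; move: (k.+1%:R^-1) => z; lra.
rewrite FE; have mF n : measurable (F n) by exact: measurable_le.
have cF : P (F n) @[n --> \oo] --> P (\bigcup_n F n).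
  apply: nondecreasing_cvg_mu => //; first exact: bigcup_measurable.
  move=> n m nm; apply/subsetPset => w /= /le_trans; apply.
  by rewrite lerD2l lerN2 lef_pV2 ?posrE// ler_nat.
apply: (cvge_to_le cF); apply: nearW => n.
rewrite [leLHS](_ : _ = (prob P (F n))%:E) ?lee_fin ?hp ?gtrBl ?invr_gt0//.
by rewrite /prob fineK// fin_num_measure.
Qed.

(** [VaR] is defined through [X <= r], but an atom at [v] itself must not count: approaching [v]
    from below leaves a condition on [X < v]. *)
Lemma VaR_geP v : (v <= VaR X p) = (prob P [set w | X w < v] <= p).
Proof.
apply/idP/idP => [vV|].
  by apply: prob_lt_le => r rv; apply: lt_VaR; exact: lt_le_trans vV.
apply: contraTT; rewrite -!ltNge => Vv.
have /gt_VaR/lt_le_trans : VaR X p < (VaR X p + v) / 2 by lra.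
apply; apply: prob_mono; [exact: measurable_le|exact: measurable_lt|move=> w /=; lra].
Qed.

Definition shortfall v : R := expect (fun w => Num.min (X w - v) 0).

Lemma bounded_shortfall v : bounded_rv (fun w => Num.min (X w - v) 0).
Proof.
apply: (@bounded_rv_mono (fun x => Num.min (x - v) 0) X) bX => x y xy.
by rewrite le_min !ge_min lerD2r xy lexx orbT.
Qed.

(** The integral of [min (X - v, 0)] is that of [X] over [X < v] minus [v P(X < v)], exactly the
    term that the atom correction in [CVaR] contains. *)
Lemma CVaR_shortfall :
  CVaR X p = (p^-1 * (p * VaR X p + shortfall (VaR X p)))%:E.
Proof.
set v := VaR X p; pose D := [set w | X w < v].
have mD : measurable D by exact: measurable_lt.
have XA : X @^-1` `]-oo, v[ = D by apply/seteqP; split=> w /=; rewrite in_itv.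
have XD : (\int[distribution P X]_(x in `]-oo, v[) x%:E = \int[P]_(w in D) (X w)%:E)%E.
  rewrite /distribution integral_pushforward ?XA//; exact: bounded_integrable.
have sD : ((shortfall v)%:E = \int[P]_(w in D) (X w)%:E - v%:E * P D)%E.
  rewrite /shortfall -expectE; last exact: bounded_shortfall.
  rewrite -integral_cst//.
  have := @integralB_EFin _ _ _ P D X (cst v) mD
    (bounded_integrable mD bX) (bounded_integrable mD (bounded_rv_cst v)).
  move=> <-; rewrite [RHS]integral_mkcond; apply: eq_integral => w _.
  rewrite patchE; case: ifPn => [|].
    by rewrite inE /D/= => wv; rewrite min_l ?subr_le0 ?(ltW wv).
  by move=> /negP; rewrite inE /D/= => /negP; rewrite -leNgt => vw; rewrite min_r ?subr_ge0.
have PD : P D = (prob P D)%:E by rewrite /prob fineK// fin_num_measure.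
have LE : (\int[P]_(w in D) (X w)%:E = (fine (\int[P]_(w in D) (X w)%:E))%:E)%E.
  by rewrite fineK//; exact/integrable_fin_num/bounded_integrable.
move: LE sD XD; set L := fine _ => -> sD XD.
have {}sD : shortfall v = L - v * prob P D by apply: EFin_inj; rewrite sD PD EFinB EFinM.
rewrite /CVaR -/v XD -[[set w | _]]/D PD sD -EFinB -EFinM.
by congr (_ * _)%:E; ring.
Qed.

(* VaR maximizes the concave function [v -> p v + E min(X - v, 0)]: below it
   the slope [p - P(X < v)] is nonnegative, above it [p - P(X <= v)] is
   negative. *)
Lemma shortfall_max v : p * v + shortfall v <= p * VaR X p + shortfall (VaR X p).
Proof.
set v0 := VaR X p; have /andP[p0 p1] := p01; have [vv0|v0v] := leP v v0.
  have P0 : prob P [set w | X w < v0] <= p by rewrite -VaR_geP.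
  have : shortfall v <= shortfall v0 + (v0 - v) * prob P [set w | X w < v0].
    rewrite -expect_indic; last exact: measurable_lt.
    have bI : bounded_rv (\1_[set w | X w < v0] : T -> R).
      exact/bounded_rv_indic/measurable_lt.
    rewrite -expectZ// -expectD; [|exact: bounded_shortfall|exact: bounded_rvZ].
    apply: le_expect; [exact: bounded_shortfall| |move=> w].
      by apply: bounded_rvD; [exact: bounded_shortfall|exact: bounded_rvZ].
    rewrite indicE; have [wv0|v0w] := ltP (X w) v0.
      by rewrite mem_set// mulr1 [Num.min (X w - v0) 0]min_l ?subr_le0 ?(ltW wv0)// ge_min; lra.
    rewrite memNset/=; last by apply/negP; rewrite -leNgt.
    by rewrite mulr0 addr0 [Num.min (X w - v0) 0]min_r ?subr_ge0// ge_min lexx orbT.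
  have : (v0 - v) * prob P [set w | X w < v0] <= (v0 - v) * p.
    by rewrite ler_wpM2l// subr_ge0.
  lra.
(* [gt_VaR] needs points strictly above [v0], so the slope is estimated from [r] on, and [r] then
   approaches [v0]. *)
have key r : v0 < r -> r < v -> shortfall v + (v - r) * p <= shortfall v0.
  move=> v0r rv; have Pr := ltW (gt_VaR v0r).
  apply: (@le_trans _ _ (shortfall v + (v - r) * prob P [set w | X w <= r])).
    by rewrite lerD2l ler_wpM2l// subr_ge0 ltW.
  rewrite -expect_indic; last exact: measurable_le.
  have bI : bounded_rv (\1_[set w | X w <= r] : T -> R).
    exact/bounded_rv_indic/measurable_le.
  rewrite -expectZ// -expectD; [|exact: bounded_shortfall|exact: bounded_rvZ].
  apply: le_expect; [|exact: bounded_shortfall|move=> w].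
    by apply: bounded_rvD; [exact: bounded_shortfall|exact: bounded_rvZ].
  rewrite indicE; have [wr|rw] := leP (X w) r.
    rewrite mem_set// mulr1 [Num.min (X w - v) 0]min_l; last by lra.
    by rewrite le_min; apply/andP; split; lra.
  rewrite memNset/=; last by apply/negP; rewrite -ltNge.
  rewrite mulr0 addr0 [Num.min (X w - v0) 0]min_r; last by lra.
  by rewrite ge_min lexx orbT.
apply/ler_addgt0Pr => e e0.
(* Half the distance keeps [r] below [v], and [e / p] makes the error [p * (r - v0)] at most [e]. *)
pose r := v0 + Num.min (e / p) ((v - v0) / 2).
have m0 : 0 < Num.min (e / p) ((v - v0) / 2) by rewrite lt_min divr_gt0//=; lra.
have m1 : Num.min (e / p) ((v - v0) / 2) <= (v - v0) / 2 by rewrite ge_min lexx orbT.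
have m2 : p * Num.min (e / p) ((v - v0) / 2) <= e.
  by rewrite mulrC -ler_pdivlMr// ge_min lexx.
have := key r; rewrite /r; move: (Num.min _ _) m0 m1 m2 => m m0 m1 m2 k.
have := k ltac:(lra) ltac:(lra); lra.
Qed.

End BoundedExpectation.

(** * Optimal memoryless policies and the three criteria *)

Section DeterministicMemoryless.
Variables (R : realType) (M : mdp R).
Local Notation S := (state M).
Local Notation A := (action M).

Lemma payoff_bound (obj : objective M) : exists B : R, forall rho, `|payoff obj rho| <= B.
Proof.
case: obj => [T r|r] /=; have [B [B0 rB]] := fin_bound (fun s => ratr (r s) : R);
  exists B => rho; last exact: mean_payoff_norm_le.
by rewrite /wreach_payoff; case: pselect => [h|_]; [exact: rB|rewrite normr0 ltW].
Qed.

Lemma bounded_payoff (sigma : strategy M) obj : bounded_rv (@run_payoff R M sigma obj).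
Proof.
split; first exact: measurable_run_payoff.
by have [B hB] := payoff_bound obj; exists B => w; exact: hB.
Qed.

Lemma dm_mean_payoff_ge0 (r : S -> rat) (f : R -> R) (B : R) :
  {homo f : x y / x <= y} -> (forall s, `|ratr (r s)| <= B) -> 0 <= f (- B) ->
  exists d : S -> A, exists (dA : forall s, d s \in Av s)
    (P' : probability (run_space (policy_strategy dA)) R), induced_measure P' /\
  forall (sigma : strategy M) (P : probability (run_space sigma) R), induced_measure P ->
    expect P (f \o run_payoff (MeanPayoff r)) <= expect P' (f \o run_payoff (MeanPayoff r)).
Proof.
move=> f_mono rB f0.
have bY (sigma : strategy M) : bounded_rv (f \o @run_payoff R M sigma (MeanPayoff r)).
  exact/bounded_rv_mono/bounded_payoff.
pose okd (d : {ffun S -> A}) := [forall s, d s \in Av s].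
pose attains (d : {ffun S -> A}) (y : R) := exists (dA : forall s, d s \in Av s)
    (P' : probability (run_space (policy_strategy dA)) R), induced_measure P' /\
    y = expect P' (f \o run_payoff (MeanPayoff r)).
have /choice[val valP] : forall d, exists y, okd d -> attains d y.
  move=> d; have [/forallP dA|_] := boolP (okd d); last by exists 0.
  have [P' PI'] := policy_measure_ex dA.
  by exists (expect P' (f \o run_payoff (MeanPayoff r))) => _; exists dA, P'.
pose d0 : {ffun S -> A} := [ffun s => act0 s].
have okd0 : okd d0 by apply/forallP => s; rewrite ffunE act0_Av.
pose d := [arg max_(d > d0 | okd d) val d]%O.
have [okd_d dmax] : okd d /\ forall d', okd d' -> val d' <= val d.
  by rewrite /d; case: arg_maxP.
have [dA [P' [PI' valE]]] := valP _ okd_d.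
exists d, dA, P'; split=> // sigma P PI; rewrite -valE.
have [e [e_Av e_supp e_cert]] := secure_policy (fun s => ratr (r s) : R).
pose F s := f (value (fun s => ratr (r s) : R) s).
have F0 s : 0 <= F s.
  apply: (le_trans f0); apply/f_mono/value_ge => t.
  by have := rB t; rewrite ler_norml => /andP[].
(* The policy that follows [e] where [v] equals [F] and plays greedily elsewhere earns at least
   [v (s0 M)], and [d] is at least as good. *)
have stop b v : stopping_value F b v -> v (s0 M) <= val d.
  move=> st; pose dv : {ffun S -> A} := [ffun s => if v s == F s then e s else greedy v s].
  have okdv : okd dv.
    by apply/forallP => s; rewrite ffunE; case: ifP => _; [exact: e_Av|exact: greedy_Av].
  apply: le_trans (dmax _ okdv); have [dvA [Q [QI ->]]] := valP _ okdv.
  have nadm s m a : Defs.next (policy_strategy dvA) s m a != 0 ->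
      [pred y : S * A | y.2 == dv y.1] (s, a).
    by rewrite /= pnatr_eq0 eqb0 negbK.
  have := payoff_lower (controlled_play QI nadm) f_mono rB f0 (bY _).1 e_supp e_cert st.
  rewrite -lee_fin -(expectE Q (bY _)); apply => y /eqP ->.
  by rewrite ffunE.
have [V [FV exV Vd]] := excessive_majorant F0 stop.
apply: le_trans Vd; rewrite -lee_fin -(expectE P (bY _)).
have nadm s m a : Defs.next sigma s m a != 0 -> [pred y : S * A | y.2 \in Av y.1] (s, a).
  exact: next_Av.
exact: (payoff_upper (controlled_play PI nadm) _ f_mono rB f0 (bY _).1 FV exV).
Qed.

Lemma dm_mean_payoff (r : S -> rat) (f : R -> R) : {homo f : x y / x <= y} ->
  exists d : S -> A, exists (dA : forall s, d s \in Av s)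
    (P' : probability (run_space (policy_strategy dA)) R), induced_measure P' /\
  forall (sigma : strategy M) (P : probability (run_space sigma) R), induced_measure P ->
    expect P (f \o run_payoff (MeanPayoff r)) <= expect P' (f \o run_payoff (MeanPayoff r)).
Proof.
move=> f_mono; have [B [_ rB]] := fin_bound (fun s => ratr (r s) : R).
(* The shift gives the nonnegativity that the Fatou argument requires and changes both expectations
   by the same constant. *)
pose g x := f x + - f (- B).
have g_mono : {homo g : x y / x <= y} by move=> x y /f_mono; rewrite lerD2r.
have g0 : 0 <= g (- B) by rewrite /g subrr.
have [d [dA [P' [PI' H]]]] := dm_mean_payoff_ge0 g_mono rB g0.
exists d, dA, P'; split=> // sigma P PI; have := H sigma P PI.
have bY (sigma' : strategy M) : bounded_rv (f \o @run_payoff R M sigma' (MeanPayoff r)).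
  exact/bounded_rv_mono/bounded_payoff.
rewrite (expectD P (bY _) (bounded_rv_cst _ _)) (expectD P' (bY _) (bounded_rv_cst _ _)).
by rewrite !expect_cst lerD2r.
Qed.

(* On an absorbing target, weighted reachability is the mean payoff of the
   reward restricted to the target. *)
Definition target_reward (T : {set S}) (r : S -> rat) (s : S) : rat :=
  if s \in T then r s else 0.

Lemma mean_payoff_cst (r : S -> rat) (rho : nat -> S) (c : R) N :
  (forall i, (N <= i)%N -> ratr (r (rho i)) = c) -> mean_payoff r rho = c.
Proof.
move=> rc; have cst k eps : 0 < eps ->
    \forall n \near \oo, \sum_(i < n) k <= n%:R * (k + eps) :> R.
  move=> eps0; apply: nearW => n; rewrite sumr_const card_ord -(mulr_natl k).
  by rewrite ler_wpM2l// lerDl ltW.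
apply/eqP; rewrite eq_le; apply/andP; split.
  apply: mean_payoff_le.
  apply: (@avg_le_tail _ (fun i => ratr (r (rho i))) (fun=> c) c N) => // eps; exact: cst.
apply: mean_payoff_ge.
apply: (@avg_le_tail _ (fun i => - ratr (r (rho i))) (fun=> - c) (- c) N) => [i Ni|eps].
  by rewrite rc.
exact: cst.
Qed.

Lemma wreach_mean_payoff (sigma : strategy M) (P : probability (run_space sigma) R)
    (T : {set S}) (r : S -> rat) : absorbing T -> induced_measure P ->
  {ae P, forall rho, run_payoff (WReach T r) rho =
    run_payoff (MeanPayoff (target_reward T r)) rho}.
Proof.
move=> absT PI.
have nadm s m a : Defs.next sigma s m a != 0 -> [pred y : S * A | y.2 \in Av y.1] (s, a).
  exact: next_Av.
have ctrl := controlled_play PI nadm.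
apply: filterS2 (ae_adm ctrl) (ae_support ctrl) => rho av sup.
rewrite /run_payoff /= /wreach_payoff; set st := fun i => config_state (rho i).
case: pselect => [h|nh]; last first.
  apply/esym/(@mean_payoff_cst _ _ _ 0) => i _; rewrite /target_reward.
  by case: ifPn => [iT|_]; [case: nh; exists i|rewrite rmorph0].
case: ex_minnP => n nT _; apply/esym/(@mean_payoff_cst _ _ _ n) => i ni.
suff -> : st i = st n by rewrite /target_reward nT.
elim: i ni => [|i IH]; first by rewrite leqn0 => /eqP ->.
rewrite leq_eqVlt => /predU1P[->//|]; rewrite ltnS => ni.
rewrite -(IH ni); have iT : st i \in T by rewrite IH.
(* [Delta a (st i) = 1] exhausts the mass, so a different next state has probability 0 and almost no
   run leaves [st i]. *)
have := absT _ _ iT (av i); have := sup i; rewrite /play /= -/(st i) -/(st i.+1).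
set a := (rho i).2 => Dne D1; apply/eqP/negPn/negP => sne.
have := sum_distr (Delta a); rewrite (bigD1 (st i))//= D1 => /eqP.
rewrite -subr_eq0 addrAC subrr add0r => /eqP/psumr_eq0P H.
by move/eqP: Dne; apply; apply: H => // t _; exact: dfun_ge0.
Qed.

Lemma dm_sufficient (obj : objective M) (f : R -> R) : wf_objective obj ->
  {homo f : x y / x <= y} ->
  exists sigma' : strategy M, deterministic_memoryless sigma' /\
  exists P' : probability (run_space sigma') R, induced_measure P' /\
  forall (sigma : strategy M) (P : probability (run_space sigma) R), induced_measure P ->
    expect P (f \o run_payoff obj) <= expect P' (f \o run_payoff obj).
Proof.
case: obj => [T r /= absT|r _] f_mono.
  have [d [dA [P' [PI' H]]]] := dm_mean_payoff (target_reward T r) f_mono.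
  exists (policy_strategy dA); split; first exact: policy_strategy_dm.
  exists P'; split=> // sigma P PI.
  have e (s : strategy M) (Q : probability (run_space s) R) : induced_measure Q ->
      expect Q (f \o run_payoff (WReach T r)) =
      expect Q (f \o run_payoff (MeanPayoff (target_reward T r))).
    move=> QI; rewrite /expect /Rintegral; congr fine.
    have bf o : bounded_rv (f \o @run_payoff R M s o).
      exact/bounded_rv_mono/bounded_payoff.
    apply: ae_eq_integral => //.
    - by apply/measurable_EFinP; exact: (bf _).1.
    - by apply/measurable_EFinP; exact: (bf _).1.
    - by apply: filterS (wreach_mean_payoff r absT QI) => rho /= -> _.
  by rewrite !e//; exact: H.
have [d [dA [P' [PI' H]]]] := dm_mean_payoff r f_mono.
exists (policy_strategy dA); split; first exact: policy_strategy_dm.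
by exists P'.
Qed.

End DeterministicMemoryless.

Theorem theorem5p16 (R : realType) (M : mdp R) (obj : objective M)
    (crit : {set criterion}) (c : constraint R) :
  wf_objective obj ->
  #|crit| = 1%N ->
  criterion_of c \in crit ->
  wf_constraint c ->
  (exists sigma : strategy M, satisfies sigma obj c) ->
  exists sigma : strategy M,
    deterministic_memoryless sigma /\ satisfies sigma obj c.
Proof.
move=> wfo _ _ wfc [sigma [P [PI]]].
have bX s := @bounded_payoff R M s obj.
case: c wfc => [e _|p c p01|q v q01] /=.
- have [s' [dm [P' [PI' H]]]] := dm_sufficient wfo (fun x y (xy : x <= y) => xy : id x <= id y).
  rewrite expectation_def (expectE P (bX _)) lee_fin => eP.
  exists s'; split=> //; exists P'; split=> //=.
  rewrite expectation_def (expectE P' (bX _)) lee_fin.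
  exact: le_trans eP (H _ _ PI).
- rewrite (CVaR_shortfall _ (bX _)) lee_fin => cP.
  (* The threshold stays frozen at the VaR of the given strategy. The new strategy may have another
     VaR, but by [shortfall_max] its own one only increases [p * v + shortfall v]. *)
  set v := VaR _ p in cP.
  have [x y xy|s' [dm [P' [PI' H]]]] := dm_sufficient wfo (f := fun x => Num.min (x - v) 0).
    by rewrite le_min !ge_min lerD2r xy lexx orbT.
  exists s'; split=> //; exists P'; split=> //=.
  have /andP[p0 _] := p01; have := H _ _ PI => HP.
  rewrite (CVaR_shortfall _ (bX _)) lee_fin (le_trans cP)// ler_pM2l ?invr_gt0//.
  by apply: le_trans (shortfall_max (X := run_payoff obj) (bX _) p01 v); rewrite lerD2l.
- rewrite (VaR_geP (X := run_payoff obj) (bX _) q01) => vP.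
  have [x y xy|s' [dm [P' [PI' H]]]] := dm_sufficient wfo (f := fun x : R => (v <= x)%R%:R).
    by rewrite ler_nat; case: (leP v x) => // /le_trans/(_ xy) ->.
  exists s'; split=> //; exists P'; split=> //=.
  rewrite (VaR_geP (X := run_payoff obj) (bX _) q01).
  have eP s (Q : probability (run_space s) R) :
      expect Q ((fun x : R => (v <= x)%R%:R) \o run_payoff obj) =
      1 - prob Q [set w | run_payoff obj w < v].
    have mA := measurable_lt (run_payoff obj : {RV Q >-> R}) v.
    rewrite -(expect_indic Q mA) -[X in _ = X - _](expect_cst Q 1) -mulN1r -expectZ;
      last exact: bounded_rv_indic.
    rewrite -expectD; [|exact: bounded_rv_cst|exact/bounded_rvZ/bounded_rv_indic].
    congr (expect Q _); apply/funext => w /=; rewrite indicE.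
    case: (leP v (run_payoff obj w)) => vw.
      by rewrite memNset ?mulr0 ?addr0//=; apply/negP; rewrite -leNgt.
    by rewrite mem_set// mulr1 addrN.
  by have := H _ _ PI; rewrite !eP lerD2l lerN2 => /le_trans; apply.
Qed.
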